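(* Let $U\in\mathrm{SpSt}(2n,2k)$ and $\Delta\in\mathrm{Hor}^{\rho,g}_U\mathrm{SpSt}(2n,2k)$. The lifted symplectic Grassmann geodesic from $U$ in direction $\Delta$ (for the Riemannian metric $g^{\mathrm{SpGr}}$) is given by $$\mathrm{Exp}^{\mathrm{SpGr}}_U(t\Delta)=\exp\big(t(\bar\Omega-\bar\Omega^T)\big)\exp\big(t\bar\Omega^T\big)U,$$ where $$\bar\Omega=\Delta(U^TU)^{-1}U^T+J_{2n}U(U^TU)^{-1}\Delta^T\left(I_{2n}-J_{2n}^TU(U^TU)^{-1}U^TJ_{2n}\right)J_{2n}.$$
   Context: Let $k\le n$ be positive integers, $J_{2m}=\begin{bmatrix}0&I_m\\-I_m&0\end{bmatrix}$, and for a real $2a\times 2b$ matrix $A$ put $A^+:=J_{2b}^TA^TJ_{2a}$. $\mathfrak{sp}(2k,\mathbb{R})=\{\Omega\in\mathbb{R}^{2k\times2k}:\Omega^+=-\Omega\}$. $\mathrm{SpSt}(2n,2k)=\{U\in\mathbb{R}^{2n\times2k}:U^+U=I_{2k}\}$ with $T_U\mathrm{SpSt}(2n,2k)=\{\Delta: U^+\Delta\in\mathfrak{sp}(2k,\mathbb{R})\}$; $\mathrm{SpGr}(2n,2k)=\{P\in\mathbb{R}^{2n\times2n}: P^2=P,\ \mathrm{rank}(P)=2k,\ P^+=P\}$; $\rho:\mathrm{SpSt}(2n,2k)\to\mathrm{SpGr}(2n,2k)$, $\rho(U)=UU^+$. $\mathrm{SpSt}(2n,2k)$ carries the Riemannian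 metric $$g^{\mathrm{SpSt}}_U(\Delta_1,\Delta_2)=\mathrm{tr}\left(\Delta_1^T\left(I_{2n}-\tfrac12J_{2n}^TU(U^TU)^{-1}U^TJ_{2n}\right)\Delta_2(U^TU)^{-1}\right),$$ which is invariant under $U\mapsto UN$, $N\in\mathrm{Sp}(2k,\mathbb{R})=\{N:N^+N=I_{2k}\}$. The horizontal space $\mathrm{Hor}^{\rho,g}_U\mathrm{SpSt}(2n,2k)$ is the $g^{\mathrm{SpSt}}_U$-orthogonal complement of $\ker\mathrm{d}\rho_U=\{UA:A\in\mathfrak{sp}(2k,\mathbb{R})\}$, i.e. $\{(UH^+-HU^+)^TU: H\in\mathbb{R}^{2n\times2k},\ U^+H=0\}$. The Riemannian metric $g^{\mathrm{SpGr}}$ on $\mathrm{SpGr}(2n,2k)$ is $g^{\mathrm{SpGr}}_{UU^+}(\Gamma_1,\Gamma_2)=g^{\mathrm{SpSt}}_U(\Delta_1,\Delta_2)$, where $\Delta_i\in\mathrm{Hor}^{\rho,g}_U\mathrm{SpSt}(2n,2k)$ is the horizontal lift of $\Gamma_i$, i.e. $\mathrm{d}\rho_U(\Delta_i)=\Gamma_i$. The lifted symplectic Grassmann geodesic from $U$ in direction $\Delta$ is the horizontal curve in $\mathrm{SpSt}(2n,2k)$ starting at $U$ with initial velocity $\Delta$ whose image under $\rho$ is the $g^{\mathrm{SpGr}}$-geodesic starting at $UU^+$ with initial velocity $\mathrm{d}\rho_U(\Delta)$. $\exp$ is the matrix exponential. *)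

(* Defs.v *)
From HB Require Import structures.
From mathcomp Require Import all_boot all_order all_algebra.
From mathcomp Require Import all_classical all_reals all_analysis.

Set Implicit Arguments.
Unset Strict Implicit.
Unset Printing Implicit Defensive.

Import Order.TTheory GRing.Theory Num.Theory.
Import numFieldNormedType.Exports.

Local Open Scope classical_set_scope.
Local Open Scope ring_scope.

(** Riemannian geodesics of a submanifold [M] of a normed space [V], for a
    metric [g P X Y] on [M] (unrelated, in general, to the metric of [V]). *)

Section Geodesics.
Context {R : realType} {V : normedModType R}.
Implicit Types (M : set V) (g : V -> V -> V -> R) (Gam : V -> V -> V -> V).
Implicit Types (gamma : R -> V).

Definition smooth_curve gamma : Prop :=
  forall (i : nat) (t : R), derivable (derive1n i gamma) t 1.

Definition smooth_curve_in M gamma : Prop :=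
  smooth_curve gamma /\ forall t, M (gamma t).

Definition tangent_space M (P : V) : set V :=
  [set X | exists gamma, [/\ smooth_curve_in M gamma, gamma 0 = P
                           & derive1 gamma 0 = X]].

Definition vector_field_along M gamma (Y : R -> V) : Prop :=
  smooth_curve Y /\ forall t, tangent_space M (gamma t) (Y t).

(** Every affine connection on [M] has, along curves, this form: its difference
    with the differentiation of [V] is tensorial. On an embedded submanifold,
    [Gam] (with values in [V]) plays the role of the Christoffel symbols. *)
Definition covariant_derivative Gam gamma (Y : R -> V) (t : R) : V :=
  derive1 Y t + Gam (gamma t) (derive1 gamma t) (Y t).

(** Symmetry of [Gam] is the vanishing of the torsion. These conditions
    determine [Gam P] on [tangent_space M P]; its values on other vectors are
    irrelevant. *)
Definition levi_civita M g Gam : Prop :=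
  [/\ forall P, M P -> forall (a : R) (X Y Z : V), tangent_space M P X ->
        tangent_space M P Y -> tangent_space M P Z ->
        Gam P (a *: X + Y) Z = a *: Gam P X Z + Gam P Y Z,
      forall P, M P -> forall X Y : V, tangent_space M P X ->
        tangent_space M P Y -> Gam P X Y = Gam P Y X,
      forall gamma (Y : R -> V), smooth_curve_in M gamma ->
        vector_field_along M gamma Y ->
        vector_field_along M gamma (covariant_derivative Gam gamma Y)
    & forall gamma (Y Z : R -> V), smooth_curve_in M gamma ->
        vector_field_along M gamma Y -> vector_field_along M gamma Z ->
        forall t : R,
        is_derive t 1 (fun s => g (gamma s) (Y s) (Z s))
          (g (gamma t) (covariant_derivative Gam gamma Y t) (Z t)
           + g (gamma t) (Y t) (covariant_derivative Gam gamma Z t))].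

Definition geodesic M g gamma : Prop :=
  smooth_curve_in M gamma /\
  exists2 Gam, levi_civita M g Gam
    & forall t, covariant_derivative Gam gamma (derive1 gamma) t = 0.

End Geodesics.

Section MatrixExponential.
Context {R : realType} {m : nat}.

Definition expmx (A : 'M[R]_m) : 'M[R]_m :=
  limn (series (fun i : nat => (i`!%:R : R)^-1 *: A ^+ i)).

End MatrixExponential.

Section Symplectic.
Context {R : realType}.

(** Matrices of even size [2 m] are indexed by ['I_(m + m)]. *)
Definition Jmx (m : nat) : 'M[R]_(m + m) :=
  block_mx 0 1%:M (- 1%:M) 0.

Definition sympl_inv (a b : nat) (A : 'M[R]_(a + a, b + b)) :
    'M[R]_(b + b, a + a) :=
  (Jmx b)^T *m A^T *m Jmx a.

Definition sp_algebra (k : nat) : set 'M[R]_(k + k) :=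
  [set Omega | sympl_inv Omega = - Omega].

Context {n k : nat}.
Implicit Types (U Delta : 'M[R]_(n + n, k + k)) (P : 'M[R]_(n + n)).

Definition SpSt : set 'M[R]_(n + n, k + k) :=
  [set U | sympl_inv U *m U = 1%:M].

Definition tangent_SpSt U : set 'M[R]_(n + n, k + k) :=
  [set Delta | sp_algebra (sympl_inv U *m Delta)].

Definition SpGr : set 'M[R]_(n + n) :=
  [set P | [/\ P *m P = P, \rank P = (k + k)%N & sympl_inv P = P]].

Definition rho U : 'M[R]_(n + n) := U *m sympl_inv U.

(** The differential of [rho] at [U]; [rho] is a polynomial map defined on all
    matrices, so that this is its directional derivative. *)
Definition drho U Delta : 'M[R]_(n + n) := 'D_Delta rho U.

Definition gSpSt U Delta1 Delta2 : R :=
  \tr (Delta1^T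
       *m (1%:M - 2^-1 *: ((Jmx n)^T *m U *m invmx (U^T *m U) *m U^T *m Jmx n))
       *m Delta2 *m invmx (U^T *m U)).

Definition vertical_space U : set 'M[R]_(n + n, k + k) :=
  [set Delta | tangent_SpSt U Delta /\ drho U Delta = 0].

Definition horizontal_space U : set 'M[R]_(n + n, k + k) :=
  [set Delta | tangent_SpSt U Delta
             /\ forall D, vertical_space U D -> gSpSt U Delta D = 0].

(** The value does not depend on the choice of [U], by invariance of [gSpSt]
    under the right action of Sp(2k). The junk value 0 is only used when [P] is
    not in [SpGr] or when one of [G1], [G2] is not tangent. *)
Definition gSpGr P (G1 G2 : 'M[R]_(n + n)) : R :=
  xget 0 [set r | exists U Delta1 Delta2,
    [/\ SpSt U /\ rho U = P,
        horizontal_space U Delta1 /\ drho U Delta1 = G1,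
        horizontal_space U Delta2 /\ drho U Delta2 = G2
      & r = gSpSt U Delta1 Delta2]].

Definition lifted_SpGr_geodesic U Delta (c : R -> 'M[R]_(n + n, k + k)) : Prop :=
  [/\ smooth_curve_in SpSt c,
      forall t, horizontal_space (c t) (derive1 c t),
      c 0 = U /\ derive1 c 0 = Delta,
      geodesic SpGr gSpGr (rho \o c)
    & (rho \o c) 0 = rho U /\ derive1 (rho \o c) 0 = drho U Delta].

Definition Omega_bar U Delta : 'M[R]_(n + n) :=
  Delta *m invmx (U^T *m U) *m U^T
  + Jmx n *m U *m invmx (U^T *m U) *m Delta^T
    *m (1%:M - (Jmx n)^T *m U *m invmx (U^T *m U) *m U^T *m Jmx n) *m Jmx n.

End Symplectic.

Arguments SpGr R n k : clear implicits.
Arguments gSpGr {R n} k P G1 G2.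

(* Main.v *)
Require Import Defs.
From HB Require Import structures.
From mathcomp Require Import all_boot all_order all_algebra.
From mathcomp Require Import all_classical all_reals all_analysis.
From mathcomp Require Import ring.

Set Implicit Arguments.
Unset Strict Implicit.
Unset Printing Implicit Defensive.

Import Order.TTheory GRing.Theory Num.Theory.
Import numFieldNormedType.Exports.

Local Open Scope classical_set_scope.
Local Open Scope ring_scope.

(** The symplectic Grassmannian is a homogeneous space of the group
    Sp(2n), and its metric comes from the right-invariant metric on the group
    given by half the Frobenius product [frob] on the Lie algebra. Indeed, with
    [U] fixed, [w |-> w *m U] maps the Lie algebra onto the tangent space of
    the Stiefel manifold, [Omega_bar U (w *m U)] is the component of [w]
    orthogonal to the kernel of this map, and [gSpSt U] is half the Frobenius
    product of these components ([gSpStE]). In the same way the tangent vectors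
    at a projector [P] are the brackets [lie w P], each with a unique lift
    [hlift P (lie w P)] orthogonal to the stabilizer of [P]. The horizontal
    elements of the Lie algebra have a simple description: their transposes
    are off-diagonal with respect to [P]. They are the lifts of the horizontal
    vectors of the Stiefel manifold ([horizontal_Omega_bar],
    [grass_horizontal_lift]), so that [gSpGr] is half the Frobenius product of
    the lifts ([gSpGrE]).

    Covariant differentiation of a field [Y = lie e gamma] along a curve
    with velocity [lie w gamma] is then [lie (e' + koszul w e) gamma]. This is
    a Levi-Civita connection ([levi_civita_christoffel]), and any other one
    agrees with it on tangent vectors ([levi_civita_unique]). The geodesics are
    the curves for which the lift [w] of the velocity solves the
    Euler-Poincare equation [w' = lie w w^T] ([geodesic_lift_eq]).

    Along a solution the skew part [A] of [w], more precisely [w - w^T], is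
    constant, since the right-hand side is symmetric. So the equation becomes
    [w' = lie A w], with the unique solution [exp(tA) W exp(-tA)]. A horizontal
    curve [c] in the Stiefel manifold satisfies [c' = w *m c], which integrates
    to [c t = exp(tA) exp(t W^T) U]. Conversely, for this curve the transpose of
    [w] is transported by the flow together with the projector, so that
    horizontality is preserved.

    Two facts make the argument work with the definitions as they are: the
    lift depends smoothly on the projector ([smooth_hlift]), and every
    symplectic projector comes from a symplectic basis of its range
    ([SpGr_rho]). *)

(** * Derivatives and smoothness of matrix-valued curves *)

Section MatrixDerivatives.
Context {R : realType} {V : normedModType R}.

Lemma is_derive_mxP m n (M : V -> 'M[R]_(m, n)) t v (dM : 'M[R]_(m, n)) :
  is_derive t v M dM <->
  forall i j, is_derive t v (fun x => M x i j) (dM i j).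
Proof.
split=> [[dvM <-] i j|dvM].
  have /derivable_mxP dvMij := dvM.
  by apply: DeriveDef; [exact: dvMij | rewrite derive_mx// mxE].
have Md : derivable M t v by apply/derivable_mxP => i j; apply: ex_derive.
apply: DeriveDef => //; rewrite derive_mx//; apply/matrixP => i j.
by rewrite mxE derive_val.
Qed.

Lemma is_derive_mulmx m n p (A : V -> 'M[R]_(m, n)) (B : V -> 'M[R]_(n, p))
    t v dA dB :
  is_derive t v A dA -> is_derive t v B dB ->
  is_derive t v (fun x => A x *m B x) (dA *m B t + A t *m dB).
Proof.
move=> /is_derive_mxP hA /is_derive_mxP hB; apply/is_derive_mxP => i j.
rewrite (_ : (fun x => _) = \sum_l (fun x => A x i l * B x l j)); last first.
  by apply/funext => x; rewrite mxE fct_sumE.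
apply: is_derive_eq; rewrite !mxE -big_split; apply: eq_bigr => l _ /=.
by rewrite /GRing.scale/= addrC [dA i l * _]mulrC.
Qed.

Lemma is_derive_mulmxl m n p (A : 'M[R]_(m, n)) (B : V -> 'M[R]_(n, p))
    t v dB :
  is_derive t v B dB -> is_derive t v (fun x => A *m B x) (A *m dB).
Proof.
move=> dvB; have := is_derive_mulmx (is_derive_cst A t v) dvB.
by rewrite mul0mx add0r.
Qed.

Lemma is_derive_mulmxr m n p (A : V -> 'M[R]_(m, n)) (B : 'M[R]_(n, p))
    t v dA :
  is_derive t v A dA -> is_derive t v (fun x => A x *m B) (dA *m B).
Proof.
move=> dvA; have := is_derive_mulmx dvA (is_derive_cst B t v).
by rewrite mulmx0 addr0.
Qed.

Lemma is_derive_trmx m n (A : V -> 'M[R]_(m, n)) t v dA :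
  is_derive t v A dA -> is_derive t v (fun x => (A x)^T) dA^T.
Proof.
move=> /is_derive_mxP dvA; apply/is_derive_mxP => i j; rewrite mxE.
by under eq_fun do rewrite mxE; exact: dvA.
Qed.

Lemma is_derive_mxtrace m (A : V -> 'M[R]_m) t v dA :
  is_derive t v A dA -> is_derive t v (fun x => \tr (A x)) (\tr dA).
Proof.
move=> /is_derive_mxP dvA; rewrite /mxtrace.
rewrite (_ : (fun x => _) = \sum_i (fun x => A x i i)); last first.
  by apply/funext => x; rewrite fct_sumE.
exact: is_derive_sum.
Qed.

End MatrixDerivatives.

Section SmoothCurves.
Context {R : realType}.

Section General.
Context {V : normedModType R}.
Implicit Types (f g : R -> V) (t : R).

Lemma derive1_val f t df : is_derive t 1 f df -> f^`()%classic t = df.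
Proof. by move=> dvf; rewrite derive1E derive_val. Qed.

Lemma smooth_is_derive f t : smooth_curve f -> is_derive t 1 f (f^`()%classic t).
Proof. by move=> sf; apply: DeriveDef; [exact: (sf 0%N) | rewrite derive1E]. Qed.

Lemma smooth_derive1 f : smooth_curve f -> smooth_curve f^`()%classic.
Proof. by move=> sf i t; rewrite -derive1Sn; exact: sf. Qed.

(** Curves of class C^n: the induction parameter in all proofs of
    smoothness, since the derivative of a product or of an inverse involves
    the original curves again. *)
Definition Cn n f :=
  forall (i : nat) (t : R), (i < n)%N -> derivable (derive1n i f) t 1.

Lemma smooth_CnP f : smooth_curve f <-> forall n, Cn n f.
Proof. by split=> [sf n i t _|sf i t]; [exact: sf | exact: (sf i.+1)]. Qed.

Lemma CnS n f f' : (forall t, is_derive t 1 f (f' t)) -> Cn n f' -> Cn n.+1 f.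
Proof.
move=> dvf sf' [|i] t; first by move=> _; apply: ex_derive.
rewrite ltnS derive1Sn => ltin.
suff -> : f^`()%classic = f' by exact: sf'.
by apply/funext => x; exact: derive1_val.
Qed.

Lemma Cn_derive n f t : Cn n.+1 f -> is_derive t 1 f (f^`()%classic t).
Proof.
by move=> sf; apply: DeriveDef; [exact: (sf 0%N) | rewrite derive1E].
Qed.

Lemma Cn_derive1 n f : Cn n.+1 f -> Cn n f^`()%classic.
Proof. by move=> sf i t lti; rewrite -derive1Sn; exact: sf. Qed.

Lemma CnW n f : Cn n.+1 f -> Cn n f.
Proof. by move=> sf i t lti; apply: sf; exact: ltnW. Qed.

Lemma smooth_cst (a : V) : smooth_curve (fun=> a).
Proof.
apply/smooth_CnP => n; elim: n a => [|n IHn] a; first by move=> i t; rewrite ltn0.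
by apply: CnS (IHn 0) => t; exact: is_derive_cst.
Qed.

Lemma CnD n f g : Cn n f -> Cn n g -> Cn n (fun t => f t + g t).
Proof.
elim: n f g => [|n IHn] f g sf sg; first by move=> i t; rewrite ltn0.
apply: (CnS (f' := fun t => f^`()%classic t + g^`()%classic t)).
  move=> t; have := Cn_derive t sf; have := Cn_derive t sg.
  by move=> ? ?; exact: is_deriveD.
by apply: IHn; exact: Cn_derive1.
Qed.

Lemma CnZ n (a : R) f : Cn n f -> Cn n (fun t => a *: f t).
Proof.
elim: n f => [|n IHn] f sf; first by move=> i t; rewrite ltn0.
apply: (CnS (f' := fun t => a *: f^`()%classic t)).
  by move=> t; have := Cn_derive t sf; move=> ?; exact: is_deriveZ.
by apply: IHn; exact: Cn_derive1.
Qed.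

Lemma smoothD f g :
  smooth_curve f -> smooth_curve g -> smooth_curve (fun t => f t + g t).
Proof.
move=> /smooth_CnP sf /smooth_CnP sg; apply/smooth_CnP => n; exact: CnD.
Qed.

Lemma smoothZ (a : R) f : smooth_curve f -> smooth_curve (fun t => a *: f t).
Proof. by move=> /smooth_CnP sf; apply/smooth_CnP => n; exact: CnZ. Qed.

Lemma smoothB f g :
  smooth_curve f -> smooth_curve g -> smooth_curve (fun t => f t - g t).
Proof.
move=> sf sg; under eq_fun do rewrite -scaleN1r.
by apply: smoothD => //; exact: smoothZ.
Qed.

Lemma smooth_sum (I : finType) (Q : pred I) (F : I -> R -> V) :
  (forall i, smooth_curve (F i)) ->
  smooth_curve (fun t => \sum_(i | Q i) F i t).
Proof.
move=> sF; elim: (index_enum I) => [|i s IHs].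
  by under eq_fun do rewrite big_nil; exact: smooth_cst.
under eq_fun do rewrite big_cons.
by case: (Q i) => //; exact: smoothD.
Qed.

End General.

Section Scalar.
Implicit Types (f g : R -> R) (t : R).

Lemma CnM n f g : Cn n f -> Cn n g -> Cn n (fun t => f t * g t).
Proof.
elim: n f g => [|n IHn] f g sf sg; first by move=> i t; rewrite ltn0.
apply: (CnS (f' := fun t => f t * g^`()%classic t + g t * f^`()%classic t)).
  by move=> t; exact: (is_deriveM (Cn_derive t sf) (Cn_derive t sg)).
apply: CnD.
  by apply: IHn; [exact: CnW | exact: Cn_derive1].
by apply: IHn; [exact: CnW | exact: Cn_derive1].
Qed.

Lemma smoothM f g :
  smooth_curve f -> smooth_curve g -> smooth_curve (fun t => f t * g t).
Proof.
move=> /smooth_CnP sf /smooth_CnP sg; apply/smooth_CnP => n; exact: CnM.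
Qed.

Lemma smoothV f :
  (forall t, f t != 0) -> smooth_curve f -> smooth_curve (fun t => (f t)^-1).
Proof.
move=> f0 sf; apply/smooth_CnP; elim=> [|n IHn]; first by move=> i t; rewrite ltn0.
apply: (CnS (f' := fun t => -1 * (((f t)^-1 * (f t)^-1) * f^`()%classic t))).
  move=> t; have [df ef] := smooth_is_derive t sf; apply: DeriveDef.
    exact: derivableV.
  by rewrite deriveV// ef mulN1r scaleNr expr2 invfM.
apply: CnM; first by move: n {IHn}; apply/smooth_CnP; exact: smooth_cst.
apply: CnM; first exact: CnM.
by move: n {IHn}; apply/smooth_CnP; exact: smooth_derive1.
Qed.

Lemma smooth_prod (I : finType) (F : I -> R -> R) :
  (forall i, smooth_curve (F i)) -> smooth_curve (fun t => \prod_i F i t).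
Proof.
move=> sF; elim: (index_enum I) => [|i s IHs].
  by under eq_fun do rewrite big_nil; exact: smooth_cst.
under eq_fun do rewrite big_cons.
exact: smoothM (sF i) IHs.
Qed.

End Scalar.

Section Matrix.

Lemma Cn_mxP m p n (M : R -> 'M[R]_(m, p)) :
  Cn n M <-> forall i j, Cn n (fun t => M t i j).
Proof.
elim: n M => [|n IHn] M; first by split=> _ i.
split=> [sM i j|sM].
  apply: (CnS (f' := fun t => M^`()%classic t i j)).
    by move=> t; have /is_derive_mxP := Cn_derive t sM; exact.
  by move: i j; apply/IHn; exact: Cn_derive1.
pose M' t := \matrix_(i, j) (fun t => M t i j)^`()%classic t.
apply: (CnS (f' := M')).
  move=> t; apply/is_derive_mxP => i j; rewrite mxE.
  exact: (Cn_derive t (sM i j)).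
by apply/IHn => i j; under eq_fun do rewrite mxE; exact: Cn_derive1.
Qed.

Lemma Cn_mulmxl k m p n (A : 'M[R]_(m, p)) (M : R -> 'M[R]_(p, n)) :
  Cn k M -> Cn k (fun t => A *m M t).
Proof.
elim: k M => [|k IHk] M sM; first by move=> i t; rewrite ltn0.
apply: (CnS (f' := fun t => A *m M^`()%classic t)).
  by move=> t; apply: is_derive_mulmxl; exact: Cn_derive sM.
by apply: IHk; exact: Cn_derive1.
Qed.

Lemma smooth_mxP m p (M : R -> 'M[R]_(m, p)) :
  smooth_curve M <-> forall i j, smooth_curve (fun t => M t i j).
Proof.
split=> [/smooth_CnP sM i j|sM]; apply/smooth_CnP => n.
  by have /Cn_mxP := sM n; exact.
by apply/Cn_mxP => i j; have /smooth_CnP := sM i j; exact.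
Qed.

Lemma smooth_mulmx m n p (A : R -> 'M[R]_(m, n)) (B : R -> 'M[R]_(n, p)) :
  smooth_curve A -> smooth_curve B -> smooth_curve (fun t => A t *m B t).
Proof.
move=> /smooth_mxP sA /smooth_mxP sB; apply/smooth_mxP => i j.
under eq_fun do rewrite mxE.
by apply: smooth_sum => l; exact: smoothM.
Qed.

Lemma smooth_trmx m n (A : R -> 'M[R]_(m, n)) :
  smooth_curve A -> smooth_curve (fun t => (A t)^T).
Proof.
move=> /smooth_mxP sA; apply/smooth_mxP => i j.
by under eq_fun do rewrite mxE; exact: sA.
Qed.

Lemma smooth_det m (A : R -> 'M[R]_m) :
  smooth_curve A -> smooth_curve (fun t => \det (A t)).
Proof.
move=> /smooth_mxP sA; apply: smooth_sum => s.
by apply: smoothM; [exact: smooth_cst | exact: smooth_prod].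
Qed.

Lemma smooth_invmx m (A : R -> 'M[R]_m) :
  (forall t, A t \in unitmx) -> smooth_curve A ->
  smooth_curve (fun t => invmx (A t)).
Proof.
move=> uA sA; apply/smooth_mxP => i j.
under eq_fun do rewrite /invmx uA !mxE.
apply: smoothM.
  by apply: smoothV; [move=> t; rewrite -unitfE -unitmxE | exact: smooth_det].
apply: smoothM; first exact: smooth_cst.
apply: smooth_det; apply/smooth_mxP => i' j'.
by under eq_fun do rewrite !mxE; move/smooth_mxP: sA; exact.
Qed.

Lemma is_derive_mx0_cst m p (M : R -> 'M[R]_(m, p)) :
  (forall t : R, is_derive t 1 M 0) -> forall t, M t = M 0.
Proof.
move=> dvM t; apply/matrixP => i j.
apply: (is_derive_0_is_cst (f := fun t => M t i j)) => x.
by have /is_derive_mxP/(_ i j) := dvM x; rewrite mxE.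
Qed.

End Matrix.
End SmoothCurves.

Arguments smooth_cst {R V} a.

(** * The matrix exponential *)

Section MatrixExponentialTheory.
Context {R : realType} {m : nat}.
Implicit Types A B : 'M[R]_m.

Lemma cvg_mx p q (F : nat -> 'M[R]_(p, q)) (l : 'M[R]_(p, q)) :
  (forall i j, F x i j @[x --> \oo] --> l i j) -> F x @[x --> \oo] --> l.
Proof.
move=> Fl; apply/cvgrPdist_le => /= e e0; near=> x.
rewrite /Num.Def.normr/= mx_normrE (bigmax_le _ (ltW e0))//= => i _.
rewrite !mxE; move: i; near: x; apply: filter_forall => /= i.
exact: ((cvgrPdist_le _ _).1 (Fl i.1 i.2)).
Unshelve. all: by end_near. Qed.

(** The coefficients of the real power series in [t] which is the entry
    [(j, k)] of [expmx (t *: A) *m B]. The factor [B] makes the family closed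
    under differentiation, which replaces [B] by [A *m B]. *)
Definition expmx_coef A B j k (i : nat) : R := (i`!%:R)^-1 * (A ^+ i *m B) j k.

Lemma mulmx_pow_bound A B : exists K b, [/\ 0 <= K, 0 <= b &
  forall i j k, `|(A ^+ i *m B) j k| <= b * K ^+ i].
Proof.
pose nrm (C : 'M[R]_m) : R := \sum_j \sum_k `|C j k|.
have nrm0 C : 0 <= nrm C by apply: sumr_ge0 => j _; apply: sumr_ge0.
have le_row (C : 'M[R]_m) j : \sum_k `|C j k| <= nrm C.
  by rewrite /nrm [leRHS](bigD1 j)//= lerDl; apply: sumr_ge0 => l _; apply: sumr_ge0.
exists (nrm A), (nrm B); split=> // i; elim: i => [|i IHi] j k.
  rewrite expr0 mul1mx mulr1; apply: le_trans (le_row B j).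
  by rewrite [leRHS](bigD1 k)//= lerDl; apply: sumr_ge0.
rewrite exprS -mulmxE -mulmxA mxE; apply: le_trans (ler_norm_sum _ _ _) _.
apply: (@le_trans _ _ (\sum_l `|A j l| * (nrm B * nrm A ^+ i))).
  by apply: ler_sum => l _; rewrite normrM ler_wpM2l.
rewrite -mulr_suml exprS [leRHS]mulrCA; apply: ler_wpM2r => //.
by rewrite mulr_ge0// exprn_ge0.
Qed.

Lemma is_cvg_expmx_coef A B j k x : cvgn (pseries (expmx_coef A B j k) x).
Proof.
have [K [b [K0 b0 bnd]]] := mulmx_pow_bound A B.
apply: normed_cvg.
apply: (@series_le_cvg _ _ (fun n => b * exp_coeff (K * `|x|) n)) => // n.
- exact: normr_ge0.
- by rewrite mulr_ge0// exp_coeff_ge0// mulr_ge0.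
- rewrite /expmx_coef /exp_coeff/= !normrM normfV normr_nat normrX exprMn.
  rewrite -mulrA mulrC !mulrA ler_wpM2r ?invr_ge0// ler_wpM2r ?exprn_ge0//.
by apply: is_cvg_seriesZ; exact: is_cvg_series_exp_coeff.
Qed.

Lemma pseries_diffs_expmx_coef A B j k :
  pseries_diffs (expmx_coef A B j k) = expmx_coef A (A *m B) j k.
Proof.
apply/funext => i; rewrite /pseries_diffs /expmx_coef factS natrM invfM.
by rewrite exprSr -mulmxE -mulmxA mulrA mulVKf.
Qed.

Lemma exprZmx (x : R) A i : (x *: A) ^+ i = x ^+ i *: A ^+ i.
Proof.
elim: i => [|i IHi]; first by rewrite !expr0 scale1r.
by rewrite !exprS IHi -!mulmxE -scalemxAl -scalemxAr scalerA.
Qed.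

Lemma expmx_mulE A B x : expmx (x *: A) *m B =
  \matrix_(j, k) limn (pseries (expmx_coef A B j k) x).
Proof.
pose s C n := \matrix_(j, k) pseries (expmx_coef A C j k) x n.
have sE n : series (fun i : nat => (i`!%:R : R)^-1 *: (x *: A) ^+ i) n = s 1 n.
  apply/matrixP => j k; rewrite mxE /pseries /series/= summxE.
  apply: eq_bigr => i _; rewrite mxE exprZmx mxE /expmx_coef.
  by rewrite mulmx1 mulrA mulrAC.
have s_cvg C : s C n @[n --> \oo] -->
    (\matrix_(j, k) limn (pseries (expmx_coef A C j k) x) : 'M[R]_m).
  apply: cvg_mx => j k; rewrite mxE; under eq_fun do rewrite mxE.
  exact: is_cvg_expmx_coef.
have -> : expmx (x *: A) = \matrix_(j, k) limn (pseries (expmx_coef A 1 j k) x).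
  rewrite /expmx (_ : series _ = s 1); last by apply/funext => n; exact: sE.
  by apply/cvg_lim => //; exact: s_cvg.
apply/matrixP => j k; rewrite !mxE.
apply/esym/cvg_lim => //.
rewrite (_ : pseries _ _ =
    (fun n => \sum_l pseries (expmx_coef A 1 j l) x n * B l k)); last first.
  apply/funext => n; rewrite /pseries /series/=.
  under [RHS]eq_bigr do rewrite mulr_suml.
  rewrite exchange_big; apply: eq_bigr => i _ /=.
  rewrite /expmx_coef mxE mulr_sumr mulr_suml; apply: eq_bigr => l _.
  by rewrite mulmx1; ring.
elim: (index_enum _) => [|l r IHr].
  by rewrite big_nil; under eq_fun do rewrite big_nil; exact: cvg_cst.
rewrite big_cons; under eq_fun do rewrite big_cons.
by apply: cvgD IHr; rewrite mxE; apply: cvgMr_tmp; exact: is_cvg_expmx_coef.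
Qed.

Lemma expmxE A x :
  expmx (x *: A) = \matrix_(j, k) limn (pseries (expmx_coef A 1 j k) x).
Proof. by rewrite -expmx_mulE mulmx1. Qed.

Lemma trmx_exp A i : (A ^+ i)^T = A^T ^+ i.
Proof.
elim: i => [|i IHi]; first by rewrite !expr0 trmx1.
by rewrite exprS exprSr -!mulmxE trmx_mul IHi.
Qed.

Lemma trmx_expmx A (x : R) : (expmx (x *: A))^T = expmx (x *: A^T).
Proof.
apply/matrixP => j k; rewrite !expmxE !mxE; congr (limn (pseries _ _)).
by apply/funext => i; rewrite /expmx_coef !mulmx1 -trmx_exp mxE.
Qed.

Lemma expmx0 A : expmx (0 *: A) = 1%:M.
Proof.
rewrite expmxE; apply/matrixP => j k; rewrite !mxE; apply/cvg_lim => //.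
rewrite -cvg_shiftS (_ : (fun n => _) = cst (j == k)%:R); first exact: cvg_cst.
apply/funext => n; rewrite /pseries /series/= big_nat_recl//= big1_seq.
  by rewrite addr0 /expmx_coef fact0 invr1 mul1r !expr0 mulr1 mulmx1 mxE.
by move=> i _; rewrite exprS mul0r mulr0.
Qed.

Lemma is_derive_expmxr A (t : R) :
  is_derive t 1 (fun s => expmx (s *: A)) (expmx (t *: A) *m A).
Proof.
apply/is_derive_mxP => j k; rewrite expmx_mulE mxE.
under eq_fun do rewrite expmxE mxE.
have := pseries_diffs_expmx_coef A 1 j k; rewrite mulmx1 => <-.
apply: (@pseries_snd_diffs _ _ (`|t| + 1)); last first.
  by rewrite [ltRHS]ger0_norm ?ltrDl// addr_ge0.
all: rewrite ?pseries_diffs_expmx_coef; exact: is_cvg_expmx_coef.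
Qed.

(** Transposition exchanges the two sides of the derivative; together with
    [is_derive_expmxr] this shows that [A] commutes with its exponential,
    without manipulation of the series. *)
Lemma is_derive_expmxl A (t : R) :
  is_derive t 1 (fun s => expmx (s *: A)) (A *m expmx (t *: A)).
Proof.
have := is_derive_trmx (is_derive_expmxr A^T t).
rewrite trmx_mul trmxK trmx_expmx trmxK.
by under eq_fun do rewrite trmx_expmx trmxK.
Qed.

Lemma expmx_comm A (t : R) : A *m expmx (t *: A) = expmx (t *: A) *m A.
Proof.
by rewrite -(derive1_val (is_derive_expmxl A t))
  (derive1_val (is_derive_expmxr A t)).
Qed.

Lemma smooth_expmx A : smooth_curve (fun t : R => expmx (t *: A)).
Proof.
apply/smooth_CnP; elim=> [|n IHn]; first by move=> i t; rewrite ltn0.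
apply: CnS (is_derive_expmxl A) _.
exact: Cn_mulmxl.
Qed.

Lemma expmxNl A (t : R) : expmx (t *: - A) *m expmx (t *: A) = 1%:M.
Proof.
have dv (s : R) :
    is_derive s 1 (fun t => expmx (t *: - A) *m expmx (t *: A)) 0.
  have := is_derive_mulmx (is_derive_expmxr (- A) s) (is_derive_expmxl A s).
  by rewrite mulmxN mulNmx mulmxA addNr.
by rewrite (is_derive_mx0_cst dv t) !expmx0 mulmx1.
Qed.

Lemma expmxNr A (t : R) : expmx (t *: A) *m expmx (t *: - A) = 1%:M.
Proof. by have := expmxNl (- A) t; rewrite opprK. Qed.

End MatrixExponentialTheory.

Arguments smooth_expmx {R m} A.

(** * The horizontal lift at an idempotent *)

Section MatrixLieAlgebra.
Context {R : realType} {N : nat}.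
Implicit Types A P X Y Z w : 'M[R]_N.

Lemma mxaddE m n (A B : 'M[R]_(m, n)) i j : (A + B) i j = A i j + B i j.
Proof. by rewrite mxE. Qed.

Lemma mxoppE m n (A : 'M[R]_(m, n)) i j : (- A) i j = - A i j.
Proof. by rewrite mxE. Qed.

Lemma mxscaleE m n a (A : 'M[R]_(m, n)) i j : (a *: A) i j = a * A i j.
Proof. by rewrite mxE. Qed.

Lemma mx0E m n i j : (0 : 'M[R]_(m, n)) i j = 0.
Proof. by rewrite mxE. Qed.

Definition lie X Y := X *m Y - Y *m X.

Definition frob m n (X Y : 'M[R]_(m, n)) : R := \tr (X^T *m Y).

(** The conditions [P *m X *m P = 0] and [(1 - P) *m X *m (1 - P) = 0], in a
    form that is linear in [X] and, on curves of idempotents, is the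
    derivative of [P *m P = P]. *)
Definition offdiag P X := P *m X + X *m P = X.

Definition diagpart P X := P *m X *m P + (1%:M - P) *m X *m (1%:M - P).

End MatrixLieAlgebra.

(* Identities of noncommutative polynomials: after expansion they are linear
   in the entries of the monomials, which [ring] treats as atoms. *)
Ltac mxexpand := rewrite ?(mulmxDl, mulmxDr, mulmxBl, mulmxBr, mulmxN, mulNmx,
  mul1mx, mulmx1, mul0mx, mulmx0, mulmxA, =^~ scalemxAl, =^~ scalemxAr).
Ltac mxlin := apply/matrixP => ? ?; rewrite !(mxaddE, mxoppE, mxscaleE, mx0E);
  ring.

Section MatrixLieAlgebraTheory.
Context {R : realType} {N : nat}.
Implicit Types (A P X Y Z w : 'M[R]_N) (a : R).

Lemma frobC X Y : frob X Y = frob Y X.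
Proof. by rewrite /frob -mxtrace_tr trmx_mul trmxK. Qed.

Lemma frobDl X Y Z : frob (X + Y) Z = frob X Z + frob Y Z.
Proof. by rewrite /frob linearD mulmxDl linearD. Qed.

Lemma frobZl a X Z : frob (a *: X) Z = a * frob X Z.
Proof. by rewrite /frob linearZ -scalemxAl linearZ. Qed.

Lemma frobNl X Z : frob (- X) Z = - frob X Z.
Proof. by rewrite -scaleN1r frobZl mulN1r. Qed.

Lemma frobDr X Y Z : frob Z (X + Y) = frob Z X + frob Z Y.
Proof. by rewrite !(frobC Z) frobDl. Qed.

Lemma frobZr a X Z : frob Z (a *: X) = a * frob Z X.
Proof. by rewrite !(frobC Z) frobZl. Qed.

Lemma frobNr X Z : frob Z (- X) = - frob Z X.
Proof. by rewrite !(frobC Z) frobNl. Qed.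

Lemma frobE m n (X Y : 'M[R]_(m, n)) : frob X Y = \sum_i \sum_j X i j * Y i j.
Proof.
rewrite exchange_big; apply: eq_bigr => j _; rewrite mxE.
by apply: eq_bigr => i _; rewrite mxE.
Qed.

Lemma frob_ge0 m n (X : 'M[R]_(m, n)) : 0 <= frob X X.
Proof.
by rewrite frobE; apply: sumr_ge0 => i _; apply: sumr_ge0 => j _; exact: sqr_ge0.
Qed.

Lemma frob_eq0 m n (X : 'M[R]_(m, n)) : frob X X = 0 -> X = 0.
Proof.
have ge0 i : 0 <= \sum_j X i j * X i j.
  by apply: sumr_ge0 => j _; exact: sqr_ge0.
rewrite frobE => /eqP; rewrite psumr_eq0// => /allP/= X0.
apply/matrixP => i j; rewrite mxE; apply/eqP.
have := X0 i (mem_index_enum _); rewrite psumr_eq0; last first.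
  by move=> l _; exact: sqr_ge0.
by move=> /allP/(_ j (mem_index_enum _)); rewrite /= mulf_eq0 orbb.
Qed.

Lemma frob_mull A X Y : frob (A *m X) Y = frob X (A^T *m Y).
Proof. by rewrite /frob trmx_mul mulmxA. Qed.

Lemma frob_mulr A X Y : frob (X *m A) Y = frob X (Y *m A^T).
Proof. by rewrite /frob trmx_mul -mulmxA mxtrace_mulC mulmxA. Qed.

Lemma frob_sandwich A X Y : frob (A *m X *m A) Y = frob X (A^T *m Y *m A^T).
Proof. by rewrite (frob_mulr A) (frob_mull A) mulmxA. Qed.

Lemma frob_lie A X Y : frob (lie A X) Y = frob X (lie A^T Y).
Proof.
by rewrite /lie frobDl frobDr frobNl frobNr frob_mull frob_mulr.
Qed.

Lemma frob_lier P X Y : frob (lie X P) Y = frob X (lie Y P^T).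
Proof.
by rewrite /lie frobDl frobDr frobNl frobNr (frob_mull P) (frob_mulr P).
Qed.

Lemma frob_diagpart P X Y : frob (diagpart P X) Y = frob X (diagpart P^T Y).
Proof.
have QT : (1%:M - P)^T = 1%:M - P^T by rewrite linearB/= trmx1.
by rewrite /diagpart -QT frobDl frobDr !frob_sandwich.
Qed.

Lemma diagpart_is_linear P : linear (diagpart P).
Proof.
move=> a X Y.
have sandwichE A : A *m (a *: X + Y) *m A = a *: (A *m X *m A) + A *m Y *m A.
  by rewrite mulmxDr mulmxDl -scalemxAr -scalemxAl.
by rewrite /diagpart !sandwichE scalerDr addrACA.
Qed.

Lemma trmx_lie X Y : (lie X Y)^T = - lie X^T Y^T.
Proof. by rewrite /lie linearB/= !trmx_mul opprB. Qed.

Lemma lie_derivation w X Y : lie w (X *m Y) = lie w X *m Y + X *m lie w Y.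
Proof. rewrite /lie; mxexpand; mxlin. Qed.

Lemma lie_jacobi X Y Z : lie (lie X Y) Z = lie X (lie Y Z) - lie Y (lie X Z).
Proof. rewrite /lie; mxexpand; mxlin. Qed.

Lemma lieDl X Y Z : lie (X + Y) Z = lie X Z + lie Y Z.
Proof. rewrite /lie; mxexpand; mxlin. Qed.

Lemma lieDr X Y Z : lie Z (X + Y) = lie Z X + lie Z Y.
Proof. rewrite /lie; mxexpand; mxlin. Qed.

Lemma lieZl a X Z : lie (a *: X) Z = a *: lie X Z.
Proof. rewrite /lie; mxexpand; mxlin. Qed.

Lemma lieZr a X Z : lie Z (a *: X) = a *: lie Z X.
Proof. rewrite /lie; mxexpand; mxlin. Qed.

Lemma lieNl X Z : lie (- X) Z = - lie X Z.
Proof. by rewrite -scaleN1r lieZl scaleN1r. Qed.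

Lemma lieC X Y : lie X Y = - lie Y X.
Proof. by rewrite /lie opprB. Qed.

Lemma lie0l X : lie 0 X = 0.
Proof. by rewrite /lie mul0mx mulmx0 subrr. Qed.

Lemma diagpart0 P : diagpart P 0 = 0.
Proof. by rewrite /diagpart mulmx0 mul0mx mulmx0 mul0mx addr0. Qed.

Lemma offdiagB P X Y : offdiag P X -> offdiag P Y -> offdiag P (X - Y).
Proof.
by move=> oX oY; rewrite /offdiag mulmxBr mulmxBl addrACA -opprD oX oY.
Qed.

Lemma offdiag_trmx P w :
  offdiag P^T w <-> offdiag P w^T.
Proof.
by rewrite /offdiag; split=> /(congr1 trmx);
  rewrite linearD/= !trmx_mul !trmxK addrC.
Qed.

Section Idempotent.
Variable P : 'M[R]_N.
Hypothesis PP : P *m P = P.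

Let mulPP m (Z : 'M[R]_(m, N)) : Z *m P *m P = Z *m P.
Proof. by rewrite -mulmxA PP. Qed.

Lemma offdiag_sandwich X : offdiag P X -> P *m X *m P = 0.
Proof.
move=> oX; have := congr1 (mulmx P) oX; rewrite mulmxDr !mulmxA PP => e.
by apply: (addrI (P *m X)); rewrite addr0.
Qed.

Lemma offdiag_lie X : offdiag P (lie X P).
Proof. rewrite /offdiag /lie; mxexpand; rewrite mulPP PP; mxlin. Qed.

Lemma sandwich_idem X : P *m (P *m X *m P) *m P = P *m X *m P.
Proof. by rewrite !mulmxA PP mulPP. Qed.

Lemma lie_sandwich X : lie (P *m X *m P) P = 0.
Proof. by rewrite /lie !mulmxA mulPP PP subrr. Qed.

Lemma lie_lieK X : offdiag P X -> lie (lie X P) P = X.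
Proof.
move=> oX; rewrite /lie; mxexpand; rewrite mulPP PP (offdiag_sandwich oX).
by rewrite -[RHS]oX; mxlin.
Qed.

Lemma diagpart_lie X : diagpart P (lie X P) = 0.
Proof. rewrite /diagpart /lie; mxexpand; rewrite ?mulPP ?PP; mxlin. Qed.

Lemma diagpart_idem X : diagpart P (diagpart P X) = diagpart P X.
Proof.
rewrite /diagpart; set Q := 1%:M - P.
have PQ : P *m Q = 0 by rewrite mulmxBr mulmx1 PP subrr.
have QP : Q *m P = 0 by rewrite mulmxBl mul1mx PP subrr.
have QQ : Q *m Q = Q by rewrite {1}/Q mulmxBl PQ subr0 mul1mx.
clearbody Q.
rewrite !mulmxDr !mulmxDl !mulmxA PP PQ QP QQ !mul0mx mulPP.
by rewrite addr0 add0r -[_ *m Q *m Q]mulmxA QQ.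
Qed.

Lemma diagpart_eq0 X : diagpart P X = 0 <-> offdiag P X.
Proof.
have e : diagpart P X = X - (P *m X + X *m P) + P *m X *m P *+ 2.
  rewrite /diagpart mulr2n; mxexpand; mxlin.
split=> [dX|oX]; last first.
  by rewrite e oX (offdiag_sandwich oX) mul0rn addr0 subrr.
have PXP : P *m X *m P = 0.
  have := congr1 (fun Z => P *m Z *m P) dX; rewrite mulmx0 mul0mx => <-.
  by rewrite /diagpart; mxexpand; rewrite ?mulPP ?PP; mxlin.
by move/eqP: e; rewrite dX PXP mul0rn addr0 eq_sym subr_eq0 => /eqP.
Qed.

End Idempotent.

Lemma trmx_idem P : P *m P = P -> P^T *m P^T = P^T.
Proof. by move=> PP; rewrite -trmx_mul PP. Qed.

(** For the inner product [frob], the matrices commuting with [P] are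
    orthogonal to those that are off-diagonal for [P^T]. *)
Lemma frob_commutant P X Z : P *m P = P -> lie X P = 0 -> offdiag P^T Z ->
  frob X Z = 0.
Proof.
move=> PP /eqP; rewrite subr_eq0 => /eqP XP oZ.
have PXP : P *m X *m P = P *m X by rewrite -mulmxA XP mulmxA PP.
have frobPX : frob (P *m X) Z = 0.
  rewrite -PXP frob_sandwich (offdiag_sandwich (trmx_idem PP) oZ).
  by rewrite /frob mulmx0 mxtrace0.
rewrite -oZ frobDr -{1}[P]trmxK -frob_mull !trmxK frobPX add0r.
by rewrite -frob_mulr XP.
Qed.

(** So a matrix that is off-diagonal for [P^T] is determined by its bracket
    with [P]: the injectivity of the horizontal lift. *)
Lemma offdiag_tr_lie_eq0 P w :
  P *m P = P -> offdiag P^T w -> lie w P = 0 -> w = 0.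
Proof. by move=> PP ow wP; apply: frob_eq0; exact: frob_commutant ow. Qed.

(** Let [ad w := lie w P], with adjoint [ad' Y := lie Y P^T] for [frob]. The
    operator [ad \o ad'] is only semidefinite: its kernel is the commutant of
    [P^T]. The second term, a composition of the same form, is definite on
    this kernel and vanishes on the off-diagonal matrices for [P^T], which
    [ad \o ad'] maps onto those for [P]. Hence the sum is invertible, and its
    inverse solves [ad w = X] in a way that is visibly smooth in [P]. *)
Definition normal_op P Y := lie (lie Y P^T) P + diagpart P (diagpart P^T Y).

Fact normal_op_is_linear P : linear (normal_op P).
Proof.
move=> a X Y; rewrite /normal_op !diagpart_is_linear.
rewrite (lieDl (a *: X) Y) (lieZl a X) (lieDl (a *: lie X P^T)) (lieZl a).
by rewrite [in RHS]scalerDr addrACA.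
Qed.

HB.instance Definition _ P :=
  GRing.isLinear.Build R 'M[R]_N 'M[R]_N *:%R (normal_op P) (normal_op_is_linear P).

(** The solution [ad' ((ad \o ad')^-1 X)] of [ad w = X]: the one orthogonal to
    the matrices commuting with [P]. *)
Definition hlift P X :=
  lie (vec_mx (mxvec X *m invmx (lin_mx (normal_op P)))) P^T.

Lemma hlift_is_linear P : linear (hlift P).
Proof.
move=> a X Y; rewrite /hlift linearP mulmxDl -scalemxAl linearP.
by rewrite (lieDl (a *: _)) (lieZl a).
Qed.

Lemma normal_op_inj P Y : P *m P = P -> normal_op P Y = 0 -> Y = 0.
Proof.
move=> PP /(congr1 (fun X => frob X Y)).
rewrite frobDl frob_lier frob_diagpart {3}/frob linear0 mul0mx mxtrace0.
move=> /eqP; rewrite paddr_eq0 ?frob_ge0// => /andP[/eqP adY /eqP dY].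
have {dY}/diagpart_eq0 := frob_eq0 dY.
move=> /(_ (trmx_idem PP)) oY; have {}adY := frob_eq0 adY.
by rewrite -(lie_lieK (trmx_idem PP) oY) adY lie0l.
Qed.

Lemma normal_mx_unit P : P *m P = P -> lin_mx (normal_op P) \in unitmx.
Proof.
move=> PP; rewrite -row_free_unit; apply: inj_row_free => v.
rewrite -[v]vec_mxK mul_vec_lin => /eqP; rewrite mxvec_eq0 => /eqP.
by move=> /(normal_op_inj PP) ->; rewrite linear0.
Qed.

(** The correction term of [normal_op] vanishes at the preimage [Y] of an
    off-diagonal [X], since [ad] takes off-diagonal values. *)
Lemma hliftP P X : P *m P = P -> offdiag P X ->
  offdiag P^T (hlift P X) /\ lie (hlift P X) P = X.
Proof.
move=> PP oX; set Y := vec_mx (mxvec X *m invmx (lin_mx (normal_op P))).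
have opY : normal_op P Y = X.
  apply: (can_inj mxvecK); rewrite -mul_vec_lin vec_mxK mulmxKV//.
  exact: normal_mx_unit.
have dY : diagpart P^T Y = 0.
  apply: frob_eq0; rewrite -frob_diagpart.
  suff -> : diagpart P (diagpart P^T Y) = 0.
    by rewrite /frob linear0 mul0mx mxtrace0.
  rewrite -diagpart_idem//; have := congr1 (diagpart P) opY.
  rewrite ((diagpart_eq0 PP X).2 oX) => <-; rewrite /normal_op.
  by rewrite -[lie _ P]scale1r diagpart_is_linear diagpart_lie// scaler0 add0r.
split; first exact/offdiag_lie/trmx_idem.
by rewrite -[RHS]opY /normal_op dY diagpart0 addr0.
Qed.

Lemma hlift_unique P w : P *m P = P -> offdiag P^T w -> hlift P (lie w P) = w.
Proof.
move=> PP ow; have [oh hE] := hliftP PP (offdiag_lie PP w).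
apply/eqP; rewrite -subr_eq0; apply/eqP; apply: (offdiag_tr_lie_eq0 PP).
  exact: offdiagB.
by rewrite (lieDl (hlift _ _)) lieNl hE subrr.
Qed.

Lemma smooth_lie (X Y : R -> 'M[R]_N) : smooth_curve X -> smooth_curve Y ->
  smooth_curve (fun t => lie (X t) (Y t)).
Proof.
by move=> sX sY; exact: smoothB (smooth_mulmx sX sY) (smooth_mulmx sY sX).
Qed.

Lemma smooth_diagpart (X Y : R -> 'M[R]_N) :
  smooth_curve X -> smooth_curve Y ->
  smooth_curve (fun t => diagpart (X t) (Y t)).
Proof.
move=> sX sY; have sQ : smooth_curve (fun t => 1%:M - X t).
  exact: smoothB (smooth_cst (1%:M : 'M[R]_N)) sX.
exact: smoothD (smooth_mulmx (smooth_mulmx sX sY) sX)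
  (smooth_mulmx (smooth_mulmx sQ sY) sQ).
Qed.

Lemma smooth_mxvec m n (A : R -> 'M[R]_(m, n)) :
  smooth_curve A <-> smooth_curve (fun t => mxvec (A t)).
Proof.
split=> /smooth_mxP sA; apply/smooth_mxP.
  move=> i j; case/mxvec_indexP: j => j k; rewrite ord1.
  by under eq_fun do rewrite mxvecE; exact: sA.
move=> i j; have := sA 0 (mxvec_index i j).
by under eq_fun do rewrite mxvecE.
Qed.

Lemma smooth_hlift (P X : R -> 'M[R]_N) :
  (forall t, P t *m P t = P t) -> smooth_curve P -> smooth_curve X ->
  smooth_curve (fun t => hlift (P t) (X t)).
Proof.
move=> PP sP sX; have sPT := smooth_trmx sP.
have uL t : lin_mx (normal_op (P t)) \in unitmx by exact: normal_mx_unit.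
have sL : smooth_curve (fun t => lin_mx (normal_op (P t))).
  apply/smooth_mxP => i j; under eq_fun do rewrite mxE /=.
  have sV := smooth_cst (vec_mx (delta_mx 0 i) : 'M[R]_N).
  have := smoothD (smooth_lie (smooth_lie sV sPT) sP)
    (smooth_diagpart sP (smooth_diagpart sPT sV)).
  by move=> /smooth_mxvec/smooth_mxP; exact.
have := smooth_mulmx ((smooth_mxvec X).1 sX) (smooth_invmx uL sL).
move=> sY; apply: smooth_lie sPT.
by apply/smooth_mxvec; under eq_fun do rewrite vec_mxK.
Qed.

Lemma is_derive_lie (X Y : R -> 'M[R]_N) (t : R) dX dY :
  is_derive t 1 X dX -> is_derive t 1 Y dY ->
  is_derive t 1 (fun s => lie (X s) (Y s)) (lie dX (Y t) + lie (X t) dY).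
Proof.
move=> hX hY.
have -> : lie dX (Y t) + lie (X t) dY =
    (dX *m Y t + X t *m dY) - (dY *m X t + Y t *m dX) by rewrite /lie; mxlin.
exact: is_deriveB (is_derive_mulmx hX hY) (is_derive_mulmx hY hX).
Qed.

Lemma is_derive_frob (X Y : R -> 'M[R]_N) (t : R) dX dY :
  is_derive t 1 X dX -> is_derive t 1 Y dY ->
  is_derive t 1 (fun s => frob (X s) (Y s)) (frob dX (Y t) + frob (X t) dY).
Proof.
move=> hX hY; rewrite /frob -[_ + _]linearD/=.
exact: is_derive_mxtrace (is_derive_mulmx (is_derive_trmx hX) hY).
Qed.

End MatrixLieAlgebraTheory.

(** * The symplectic involution and the symplectic Lie algebra *)

Section SymplecticInvolution.
Context {R : realType}.

Lemma trmx_Jmx m : (Jmx m)^T = - Jmx m :> 'M[R]_(m + m).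
Proof.
by rewrite /Jmx tr_block_mx !raddf0 raddfN /= !trmx1 opp_block_mx !oppr0 opprK.
Qed.

Lemma Jmx_sqr m : Jmx m *m Jmx m = - 1%:M :> 'M[R]_(m + m).
Proof.
rewrite /Jmx mulmx_block !(mulmx0, mul0mx, mul1mx, mulmxN, mulmx1) addr0 add0r.
by rewrite addr0 [in RHS]scalar_mx_block opp_block_mx oppr0.
Qed.

Lemma mulJtJ m : (Jmx m)^T *m Jmx m = 1%:M :> 'M[R]_(m + m).
Proof. by rewrite trmx_Jmx mulNmx Jmx_sqr opprK. Qed.

Lemma mulJJt m : Jmx m *m (Jmx m)^T = 1%:M :> 'M[R]_(m + m).
Proof. by rewrite trmx_Jmx mulmxN Jmx_sqr opprK. Qed.

Section Rectangular.
Context {a b c : nat}.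
Implicit Types (A : 'M[R]_(a + a, b + b)) (B : 'M[R]_(b + b, c + c)).

Lemma sympl_inv_is_linear : linear (@sympl_inv R a b).
Proof.
move=> x A A'; rewrite /sympl_inv linearP/= mulmxDr mulmxDl.
by rewrite -scalemxAr -scalemxAl.
Qed.

Lemma sympl_invD A A' : sympl_inv (A + A') = sympl_inv A + sympl_inv A'.
Proof. by have := sympl_inv_is_linear 1 A A'; rewrite !scale1r. Qed.

Lemma sympl_inv0 : sympl_inv (0 : 'M[R]_(a + a, b + b)) = 0.
Proof. by rewrite /sympl_inv trmx0 mulmx0 mul0mx. Qed.

Lemma sympl_invZ x A : sympl_inv (x *: A) = x *: sympl_inv A.
Proof.
by have := sympl_inv_is_linear x A 0; rewrite sympl_inv0 !addr0.
Qed.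

Lemma sympl_invN A : sympl_inv (- A) = - sympl_inv A.
Proof. by rewrite -scaleN1r sympl_invZ scaleN1r. Qed.

Lemma sympl_invM A B : sympl_inv (A *m B) = sympl_inv B *m sympl_inv A.
Proof.
rewrite /sympl_inv trmx_mul !mulmxA; congr (_ *m _); congr (_ *m _).
by rewrite -mulmxA mulJJt mulmx1.
Qed.

Lemma sympl_invK A : sympl_inv (sympl_inv A) = A.
Proof.
have JtJt m : (Jmx m)^T *m (Jmx m)^T = - 1%:M :> 'M[R]_(m + m).
  by rewrite -trmx_mul Jmx_sqr raddfN/= trmx1.
rewrite /sympl_inv !trmx_mul !trmxK !mulmxA JtJt -!mulmxA Jmx_sqr.
by rewrite mulNmx mul1mx !mulmxN mulmx1 opprK.
Qed.

Lemma trmx_sympl_inv A : (sympl_inv A)^T = sympl_inv A^T.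
Proof. by rewrite /sympl_inv !trmx_mul !trmxK !mulmxA. Qed.

Lemma is_derive_sympl_inv {V : normedModType R} (M : V -> 'M[R]_(a + a, b + b))
    t v dM :
  is_derive t v M dM ->
  is_derive t v (fun x => sympl_inv (M x)) (sympl_inv dM).
Proof.
by move=> /is_derive_trmx dv; exact: is_derive_mulmxr (is_derive_mulmxl _ dv).
Qed.

Lemma smooth_sympl_inv (M : R -> 'M[R]_(a + a, b + b)) :
  smooth_curve M -> smooth_curve (fun t => sympl_inv (M t)).
Proof.
move=> sM; have sJ d := smooth_cst (Jmx d : 'M[R]_(d + d)).
exact: smooth_mulmx (smooth_mulmx (smooth_trmx (sJ b)) (smooth_trmx sM)) (sJ a).
Qed.

End Rectangular.

Lemma sympl_inv1 m : sympl_inv (1%:M : 'M[R]_(m + m)) = 1%:M.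
Proof. by rewrite /sympl_inv trmx1 mulmx1 mulJtJ. Qed.

Section Algebra.
Context {n : nat}.
Implicit Types (A w e P X : 'M[R]_(n + n)).

Lemma sp_algebraD w e : sp_algebra w -> sp_algebra e -> sp_algebra (w + e).
Proof. by rewrite /sp_algebra/= sympl_invD opprD => -> ->. Qed.

Lemma sp_algebraZ x w : sp_algebra w -> sp_algebra (x *: w).
Proof. by rewrite /sp_algebra/= sympl_invZ -scalerN => ->. Qed.

Lemma sp_algebraN w : sp_algebra w -> sp_algebra (- w).
Proof. by rewrite -scaleN1r; exact: sp_algebraZ. Qed.

Lemma sp_algebraB w e : sp_algebra w -> sp_algebra e -> sp_algebra (w - e).
Proof. by move=> sw se; apply: sp_algebraD sw (sp_algebraN se). Qed.

Lemma sp_algebra_tr w : sp_algebra w -> sp_algebra w^T.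
Proof. by rewrite /sp_algebra/= -trmx_sympl_inv => ->; rewrite raddfN. Qed.

Lemma sympl_inv_lie w e :
  sympl_inv (lie w e) = lie (sympl_inv e) (sympl_inv w).
Proof. by rewrite /lie sympl_invD sympl_invN !sympl_invM. Qed.

Lemma sp_algebra_lie w e : sp_algebra w -> sp_algebra e -> sp_algebra (lie w e).
Proof.
rewrite /sp_algebra/= sympl_inv_lie => -> ->.
by rewrite lieC lieNl (lieC w) lieNl (lieC e) !opprK.
Qed.

Lemma sp_algebra_sandwich A w : sympl_inv A = A -> sp_algebra w ->
  sp_algebra (A *m w *m A).
Proof.
rewrite /sp_algebra/= => Ai sw.
by rewrite sympl_invM (sympl_invM A) Ai sw mulNmx mulmxN mulmxA.
Qed.

(** The linearization at [P] of the equations [P *m P = P] and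
    [sympl_inv P = P] of the Grassmannian. *)
Definition grass_tangent P X := sympl_inv X = X /\ offdiag P X.

(** The orthogonal complement, in the symplectic Lie algebra, of the
    infinitesimal stabilizer of [P]. *)
Definition grass_horizontal P w := sp_algebra w /\ offdiag P^T w.

Lemma grass_tangent_lie P w : P *m P = P -> sympl_inv P = P -> sp_algebra w ->
  grass_tangent P (lie w P).
Proof.
move=> PP Pi sw; split; last exact: offdiag_lie.
by rewrite sympl_inv_lie Pi sw lieC lieNl opprK.
Qed.

(** The matrix [- sympl_inv (hlift P X)] satisfies both conditions that
    determine [hlift P X], so that the two are equal. *)
Lemma hlift_horizontal P X : P *m P = P -> sympl_inv P = P ->
  grass_tangent P X -> grass_horizontal P (hlift P X).
Proof.
move=> PP Pi [Xi oX]; have [] := hliftP PP oX.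
move eh : (hlift P X) => h oh hE; split=> //.
have oi : offdiag P^T (- sympl_inv h).
  rewrite /offdiag mulmxN mulNmx -opprD; congr (- _).
  by rewrite -[in RHS]oh sympl_invD !sympl_invM -trmx_sympl_inv Pi addrC.
have lX : lie (- sympl_inv h) P = X.
  by rewrite lieNl lieC opprK -[in LHS]Pi -sympl_inv_lie hE.
by have := hlift_unique PP oi; rewrite lX eh /sp_algebra/= => {2}->; rewrite opprK.
Qed.

End Algebra.
End SymplecticInvolution.

(** * The Stiefel metric in the Lie algebra *)

Section StiefelGrassmann.
Context {R : realType} {n k : nat}.
Implicit Types (U D : 'M[R]_(n + n, k + k)) (w z : 'M[R]_(n + n)).

Local Notation J := (Jmx n).

Lemma corner_removedE (A B w : 'M[R]_(n + n)) :
  w - (1%:M - B) *m w *m (1%:M - A) = w *m A + B *m w *m (1%:M - A).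
Proof. by mxexpand; mxlin. Qed.

Lemma gram_unit U : SpSt U -> U^T *m U \in unitmx.
Proof.
move=> hU; rewrite -row_free_unit; apply: inj_row_free => v vG.
have Uv : U *m v^T = 0.
  apply: frob_eq0; rewrite /frob trmx_mul trmxK -mulmxA [U^T *m _]mulmxA.
  by rewrite mulmxA vG mul0mx mxtrace0.
have : v^T = 0 by rewrite -[LHS]mul1mx -hU -mulmxA Uv mulmx0.
by move=> /(congr1 trmx); rewrite trmxK trmx0.
Qed.

(** The orthogonal projector onto the range of [U]. Its image under the
    symplectic involution is the projector onto the range of [Jmx n *m U],
    which is also the range of [(rho U)^T]. *)
Definition range_proj U := U *m invmx (U^T *m U) *m U^T.

Section Frame.
Variable U : 'M[R]_(n + n, k + k).
Hypothesis hU : SpSt U.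

Let E := range_proj U.
Let F := sympl_inv E.
Let P := rho U.

Let SU : sympl_inv U *m U = 1%:M. Proof. exact: hU. Qed.

Lemma rho_idem : P *m P = P.
Proof. by rewrite /P /rho mulmxA -[_ *m _ *m U]mulmxA SU mulmx1. Qed.

Lemma rho_sympl_inv : sympl_inv P = P.
Proof. by rewrite /P /rho sympl_invM sympl_invK. Qed.

Lemma rho_mulmx : P *m U = U.
Proof. by rewrite /P /rho -mulmxA SU mulmx1. Qed.

Lemma rho_SpGr : SpGr R n k P.
Proof.
split; [exact: rho_idem | | exact: rho_sympl_inv].
apply/eqP; rewrite eqn_leq; apply/andP; split.
  by rewrite (leq_trans (mulmx_max_rank _ _))//.
have := mxrankM_maxr (sympl_inv U) (P *m U).
rewrite rho_mulmx SU mxrank1 => h; apply: leq_trans h _.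
by rewrite -{1}rho_mulmx; exact: mxrankM_maxl.
Qed.

Lemma range_proj_tr : E^T = E.
Proof.
by rewrite /E /range_proj !trmx_mul trmxK trmx_inv trmx_mul trmxK mulmxA.
Qed.

Lemma range_proj_mulmx : E *m U = U.
Proof. by rewrite /E /range_proj -mulmxA mulmxKV// gram_unit. Qed.

Lemma range_proj_eq0 w : w *m U = 0 -> w *m E = 0.
Proof. by rewrite /E /range_proj !mulmxA => ->; rewrite !mul0mx. Qed.

Lemma trmx_mul_range_proj : U^T *m E = U^T.
Proof. by rewrite -range_proj_tr -trmx_mul range_proj_mulmx. Qed.

Lemma rho_tr_range : P^T *m E = P^T.
Proof. by rewrite /P /rho trmx_mul -mulmxA trmx_mul_range_proj. Qed.

Lemma range_rho_tr : E *m P^T = E.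
Proof.
rewrite -range_proj_tr -trmx_mul; congr trmx.
by rewrite /E /range_proj !mulmxA rho_mulmx.
Qed.

Lemma sympl_inv_rho_tr : sympl_inv P^T = P^T.
Proof. by rewrite -trmx_sympl_inv rho_sympl_inv. Qed.

Lemma corange_rho_tr : F *m P^T = P^T.
Proof. by rewrite -[in LHS]sympl_inv_rho_tr -sympl_invM rho_tr_range
  sympl_inv_rho_tr. Qed.

Lemma rho_tr_corange : P^T *m F = F.
Proof. by rewrite -[P^T]sympl_inv_rho_tr -sympl_invM range_rho_tr. Qed.

Lemma corange_tr : F^T = F.
Proof. by rewrite /F trmx_sympl_inv range_proj_tr. Qed.

Lemma corangeE : F = J^T *m E *m J.
Proof. by rewrite /F /sympl_inv range_proj_tr. Qed.

Lemma corange_conjJ : F = J *m E *m J^T.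
Proof. by rewrite corangeE trmx_Jmx mulmxN !mulNmx. Qed.

Lemma corange_projE : J^T *m U *m invmx (U^T *m U) *m U^T *m J = F.
Proof. by rewrite corangeE /E /range_proj !mulmxA. Qed.

Lemma Omega_bar_mulmx D : Omega_bar U D *m U = D.
Proof.
have FJU : (1%:M - F) *m (J *m U) = 0.
  have JJU : J *m (J *m U) = - U by rewrite mulmxA Jmx_sqr mulNmx mul1mx.
  rewrite mulmxBl mul1mx corangeE trmx_Jmx !mulNmx opprK.
  rewrite -[J *m E *m J *m _]mulmxA JJU mulmxN.
  by rewrite -[J *m E *m U]mulmxA range_proj_mulmx subrr.
rewrite /Omega_bar corange_projE mulmxDl -[D *m _ *m _ *m U]mulmxA.
rewrite mulmxKV ?gram_unit// -[_ *m J *m U]mulmxA.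
by rewrite -[_ *m (1%:M - F) *m _]mulmxA FJU mulmx0 addr0.
Qed.

Lemma sp_mulJ w : sp_algebra w -> w^T *m J = - (J *m w).
Proof.
move=> sw; rewrite -mulmxN -sw /sympl_inv !mulmxA.
by rewrite mulJJt mul1mx.
Qed.

(** So [Omega_bar U] takes the element [w] of the Lie algebra to its component
    orthogonal to the infinitesimal stabilizer of [U], by removal of the
    corner of [w] from the orthogonal complement of the range of [U] to that
    of the range of [J *m U]. *)
Lemma Omega_barE w : sp_algebra w ->
  Omega_bar U (w *m U) = w - (1%:M - F) *m w *m (1%:M - E).
Proof.
move=> sw.
rewrite corner_removedE /Omega_bar; congr (_ + _); first by rewrite /E /range_proj !mulmxA.
rewrite corange_projE.
have -> : J *m U *m invmx (U^T *m U) *m (w *m U)^T = J *m E *m w^T.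
  by rewrite trmx_mul /E /range_proj !mulmxA.
have -> : J *m E *m w^T *m (1%:M - F) *m J =
    J *m E *m (w^T *m J) *m (J^T *m (1%:M - F) *m J).
  by rewrite !mulmxA -[_ *m J *m J^T]mulmxA mulJJt mulmx1.
have -> : J^T *m (1%:M - F) *m J = 1%:M - E.
  rewrite mulmxBr mulmxBl mulmx1 mulJtJ corange_conjJ !mulmxA mulJtJ mul1mx.
  by rewrite -mulmxA mulJtJ mulmx1.
rewrite sp_mulJ// mulmxN -mulNmx corange_conjJ trmx_Jmx mulmxN !mulNmx.
by rewrite !mulmxA.
Qed.

Lemma sp_Omega_bar w : sp_algebra w -> sp_algebra (Omega_bar U (w *m U)).
Proof.
move=> sw; rewrite Omega_barE//; apply: sp_algebraB => //.
have sE : sympl_inv (1%:M - E) = 1%:M - F.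
  by rewrite sympl_invD sympl_invN sympl_inv1.
have sF : sympl_inv (1%:M - F) = 1%:M - E.
  by rewrite sympl_invD sympl_invN sympl_inv1 sympl_invK.
by rewrite /sp_algebra/= !sympl_invM sE sF sw mulNmx mulmxN mulmxA.
Qed.

(** An element [z] of the infinitesimal stabilizer of [U] satisfies
    [z *m E = 0] and, by the involution, [F *m z = 0]; each of the two terms
    of the lift contains one of these projectors at the matching side. *)
Lemma Omega_bar_orth w z : sp_algebra w -> sp_algebra z -> z *m U = 0 ->
  frob (Omega_bar U (w *m U)) z = 0.
Proof.
move=> sw sz zU; have zE := range_proj_eq0 zU.
have Fz : F *m z = 0.
  have := congr1 (@sympl_inv R n n) zE; rewrite sympl_inv0 sympl_invM sz mulmxN.
  by move=> /eqP; rewrite oppr_eq0 => /eqP.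
rewrite Omega_barE// corner_removedE -[F *m w *m _]mulmxA.
by rewrite frobDl frob_mulr frob_mull range_proj_tr corange_tr zE Fz
  /frob !mulmx0 mxtrace0 addr0.
Qed.

Lemma frob_Omega_bar w z : sp_algebra w -> sp_algebra z ->
  frob (Omega_bar U (w *m U)) (Omega_bar U (z *m U)) =
  frob (Omega_bar U (w *m U)) z.
Proof.
move=> sw sz; apply/eqP; rewrite -subr_eq0 -frobNr -frobDr.
rewrite Omega_bar_orth//; first exact: (sp_algebraB (sp_Omega_bar sz)).
by rewrite mulmxBl Omega_bar_mulmx subrr.
Qed.

Lemma frob_sympl_inv w z : frob (sympl_inv w) (sympl_inv z) = frob w z.
Proof.
rewrite /frob /sympl_inv !trmx_mul !trmxK !mulmxA.
rewrite -[_ *m J *m J^T]mulmxA mulJJt mulmx1.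
rewrite mxtrace_mulC !mulmxA mulJJt mul1mx mxtrace_mulC.
by rewrite -mxtrace_tr trmx_mul trmxK mxtrace_mulC.
Qed.

(** The Frobenius product of two lifts is expanded along the corner
    decomposition of the second one. The involution is an isometry and
    exchanges the two projectors, so that the two leading terms are equal:
    this is the origin of the factor two. *)
Lemma gSpStE w z : sp_algebra w -> sp_algebra z ->
  gSpSt U (w *m U) (z *m U) =
  2^-1 * frob (Omega_bar U (w *m U)) (Omega_bar U (z *m U)).
Proof.
move=> sw sz.
set w' := Omega_bar U (w *m U); set z' := Omega_bar U (z *m U).
have sw' : sp_algebra w' := sp_Omega_bar sw.
have sz' : sp_algebra z' := sp_Omega_bar sz.
rewrite -[w *m U]Omega_bar_mulmx -/w' -[z *m U]Omega_bar_mulmx -/z'.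
have zE : z' = z' *m E + F *m z' *m (1%:M - E).
  have h : (1%:M - F) *m z' *m (1%:M - E) = 0.
    apply/oppr_inj/(addrI z').
    by rewrite -(Omega_barE sz') Omega_bar_mulmx oppr0 addr0.
  by rewrite -corner_removedE h subr0.
have Fz : frob w' (F *m z') = frob w' (z' *m E).
  rewrite -frob_sympl_inv sympl_invM sympl_invK sw' sz' mulNmx.
  by rewrite frobNl frobNr opprK.
have -> : frob w' z' = 2 * frob w' (z' *m E) - frob w' (F *m z' *m E).
  rewrite {1}zE frobDr mulmxBr mulmx1 frobDr frobNr Fz addrA.
  by rewrite mulr_natl mulr2n.
rewrite mulrBr mulrA mulVf ?pnatr_eq0// mul1r.
rewrite /gSpSt.
rewrite corange_projE.
set rhs := (RHS); rewrite trmx_mul -!mulmxA mxtrace_mulC.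
have -> : (w'^T *m ((1%:M - 2^-1 *: F) *m (z' *m (U *m invmx (U^T *m U)))))
   *m U^T = w'^T *m ((1%:M - 2^-1 *: F) *m z' *m E).
  by rewrite /E /range_proj !mulmxA.
rewrite -/(frob _ _) (mulmxBl 1%:M) mul1mx (mulmxBl z') -!scalemxAl.
by rewrite frobDr frobNr frobZr.
Qed.

End Frame.
End StiefelGrassmann.

(** * Horizontal vectors of the Stiefel manifold *)

Section HorizontalLift.
Context {R : realType} {n k : nat}.
Implicit Types (U D : 'M[R]_(n + n, k + k)) (w z : 'M[R]_(n + n)).

Lemma is_derive_rho U D :
  is_derive U D (@rho R n k) (D *m sympl_inv U + U *m sympl_inv D).
Proof.
have dU := is_derive_id U D.
exact: (is_derive_mulmx dU (is_derive_sympl_inv dU)).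
Qed.

Lemma drhoE U D : drho U D = D *m sympl_inv U + U *m sympl_inv D.
Proof. by rewrite /drho (derive_val (is_derive := is_derive_rho U D)). Qed.

Lemma drho_mulmx U w : sp_algebra w -> drho U (w *m U) = lie w (rho U).
Proof.
by move=> sw; rewrite drhoE sympl_invM sw mulmxN mulmxN /lie /rho !mulmxA.
Qed.

Lemma tangent_SpSt_mulmx U w : sp_algebra w -> tangent_SpSt U (w *m U).
Proof.
move=> sw; rewrite /tangent_SpSt/= /sp_algebra/= sympl_invM (sympl_invM w) sw.
by rewrite sympl_invK mulmxN mulNmx mulmxA.
Qed.

(** The symplectic group acts transitively on the Stiefel manifold; this is
    the infinitesimal form of that fact. *)
Lemma tangent_SpSt_lift U D : SpSt U -> tangent_SpSt U D ->
  exists2 w, sp_algebra w & w *m U = D.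
Proof.
rewrite /SpSt /tangent_SpSt /sp_algebra/= sympl_invM sympl_invK => hU hD.
exists (D *m sympl_inv U - U *m sympl_inv D
        - U *m (sympl_inv U *m D) *m sympl_inv U).
  rewrite /sp_algebra/= 2!sympl_invD 2!sympl_invN.
  rewrite (sympl_invM D) (sympl_invM U) (sympl_invM (U *m _)) (sympl_invM U).
  rewrite (sympl_invM (sympl_inv U)) !sympl_invK hD.
  by rewrite mulNmx mulmxN opprK !mulmxA; mxlin.
rewrite !mulmxBl -(mulmxA D) -(mulmxA U (sympl_inv D)).
rewrite -(mulmxA _ (sympl_inv U)) hU hD !mulmx1 mulmxN opprK.
by rewrite addrK.
Qed.

Lemma vertical_spaceP U D : SpSt U -> vertical_space U D ->
  exists z, [/\ sp_algebra z, rho U *m z *m rho U = z & z *m U = D].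
Proof.
move=> hU [hD dD]; have SU : sympl_inv U *m U = 1%:M by exact: hU.
have {dD}DE : D = U *m (sympl_inv U *m D).
  have := congr1 (fun X => X *m U) dD; rewrite drhoE mulmxDl mul0mx.
  rewrite -(mulmxA D) -(mulmxA U) SU mulmx1 => /eqP; rewrite addr_eq0 => /eqP {1}->.
  rewrite -mulmxN; congr (_ *m _).
  by move: hD; rewrite /tangent_SpSt/= /sp_algebra/= sympl_invM sympl_invK => ->;
    rewrite opprK.
exists (U *m (sympl_inv U *m D) *m sympl_inv U); split.
- rewrite /sp_algebra/= [in LHS]sympl_invM sympl_invK [in LHS]sympl_invM.
  have -> : sympl_inv (sympl_inv U *m D) = - (sympl_inv U *m D) by exact: hD.
  by rewrite mulNmx mulmxN mulmxA.
- have assoc (A B : 'M[R]_(n + n)) (X : 'M[R]_(n + n, k + k))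
      (Y : 'M[R]_(k + k)) (Z : 'M[R]_(k + k, n + n)) :
      A *m (X *m Y *m Z) *m B = (A *m X) *m Y *m (Z *m B) by rewrite !mulmxA.
  rewrite assoc rho_mulmx//; congr (_ *m _).
  by rewrite -[rho U]rho_sympl_inv -sympl_invM rho_mulmx.
- by rewrite -[LHS]mulmxA SU mulmx1 -DE.
Qed.

Lemma vertical_space_mulmx U z : SpSt U -> sp_algebra z ->
  rho U *m z *m rho U = z -> vertical_space U (z *m U).
Proof.
move=> hU sz Pz; split; first exact: tangent_SpSt_mulmx.
by rewrite drho_mulmx// -Pz lie_sandwich//; exact: rho_idem.
Qed.

Lemma gSpSt_vertical U w z : SpSt U -> sp_algebra w -> sp_algebra z ->
  gSpSt U (w *m U) (z *m U) = 2^-1 * frob (Omega_bar U (w *m U)) z.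
Proof. by move=> hU sw sz; rewrite gSpStE// frob_Omega_bar. Qed.

Lemma Omega_bar_corner U w : SpSt U -> sp_algebra w ->
  let Q := 1%:M - (rho U)^T in Q *m Omega_bar U (w *m U) *m Q = 0.
Proof.
move=> hU sw Q; rewrite Omega_barE//.
set E := range_proj U; set F := sympl_inv E.
have QE : Q *m (1%:M - F) = Q.
  rewrite mulmxBr mulmx1 {2}/Q mulmxBl mul1mx rho_tr_corange//.
  by rewrite subrr subr0.
have EQ : (1%:M - E) *m Q = Q.
  rewrite mulmxBl mul1mx {2}/Q mulmxBr mulmx1 range_rho_tr//.
  by rewrite subrr subr0.
have corner (X Y Z : 'M[R]_(n + n)) : X *m Z = X -> Y *m X = X ->
    X *m (w - Z *m w *m Y) *m X = 0.
  move=> XZ YX; rewrite mulmxBr mulmxBl !mulmxA XZ.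
  by rewrite -[X *m w *m Y *m X]mulmxA YX subrr.
exact: corner.
Qed.

(** Orthogonality to the vertical space kills the block [P^T *m w *m P^T] of
    the lift [w], for [P := rho U]: it is tested on the vertical vector defined
    by that block itself. The opposite block vanishes for every lift. *)
Lemma horizontal_Omega_bar U D : SpSt U -> horizontal_space U D ->
  grass_horizontal (rho U) (Omega_bar U D).
Proof.
move=> hU [tD oD]; have [w0 sw0 wD] := tangent_SpSt_lift hU tD.
have := sp_Omega_bar U sw0.
have := Omega_bar_corner hU sw0; rewrite wD.
set w := Omega_bar U D => /= QwQ sw; set P := rho U in QwQ *.
have PP : P *m P = P := rho_idem hU.
have Pi : sympl_inv P = P := rho_sympl_inv U.
split=> //; apply/diagpart_eq0; first exact: trmx_idem.
rewrite /diagpart QwQ addr0; set X := P^T *m w *m P^T.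
have sX : sp_algebra X.
  by apply: sp_algebra_sandwich => //; exact: sympl_inv_rho_tr.
have sz : sp_algebra (P *m X *m P) by exact: sp_algebra_sandwich.
have Pz := sandwich_idem PP X.
apply: frob_eq0; rewrite {1}/X frob_sandwich !trmxK.
have := oD _ (vertical_space_mulmx hU sz Pz).
rewrite -[in gSpSt _ D _]wD gSpSt_vertical// wD -/w => /eqP.
by rewrite mulf_eq0 invr_eq0 pnatr_eq0 /= => /eqP.
Qed.

Lemma grass_horizontal_lift U w : SpSt U -> grass_horizontal (rho U) w ->
  horizontal_space U (w *m U) /\ Omega_bar U (w *m U) = w.
Proof.
move=> hU [sw ow]; set P := rho U in ow.
have PP : P *m P = P := rho_idem hU.
have wE : Omega_bar U (w *m U) = w.
  rewrite Omega_barE//; set E := range_proj U; set F := sympl_inv E.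
  have QE : (1%:M - P^T) *m (1%:M - E) = 1%:M - E.
    by rewrite mulmxBl mul1mx mulmxBr mulmx1 rho_tr_range// subrr subr0.
  have FQ : (1%:M - F) *m (1%:M - P^T) = 1%:M - F.
    by rewrite mulmxBr mulmx1 mulmxBl mul1mx corange_rho_tr// subrr subr0.
  suff QwQ : (1%:M - P^T) *m w *m (1%:M - P^T) = 0.
    have corner (X Y Z : 'M[R]_(n + n)) : X *m Z = X -> Z *m Y = Y ->
        Z *m w *m Z = 0 -> X *m w *m Y = 0.
      move=> XZ ZY ZwZ; rewrite -XZ -ZY !mulmxA -(mulmxA X Z) -(mulmxA X).
      by rewrite ZwZ mulmx0 mul0mx.
    by rewrite (corner _ _ _ FQ QE QwQ) subr0.
  have := (diagpart_eq0 (trmx_idem PP) w).2 ow; rewrite /diagpart.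
  by rewrite offdiag_sandwich ?add0r//; exact: trmx_idem.
split=> //; split; first exact: tangent_SpSt_mulmx.
move=> D /(vertical_spaceP hU)[z [sz Pz <-]].
rewrite gSpSt_vertical// wE -Pz frobC frob_sandwich.
by rewrite offdiag_sandwich ?/frob ?mulmx0 ?mxtrace0 ?mulr0//; exact: trmx_idem.
Qed.

End HorizontalLift.

(** * Symplectic bases *)

Section SymplecticBasis.
Context {R : realType} {n : nat}.

(** It makes ranks additive under splitting of idempotents, which is what the
    induction on symplectic planes requires. *)
Lemma mxrank_idem m (P : 'M[R]_m) : P *m P = P -> (\rank P)%:R = \tr P.
Proof.
move=> PP; move: (mulmx_base P) (col_base_full P) (row_base_free P).
move: (col_base P) (row_base P) => A B PE fA fB.
have RL : B *m A = 1%:M.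
  apply: (row_full_inj fA); apply: (row_free_inj fB).
  by rewrite /= mulmx1 !mulmxA PE -(mulmxA P) PE PP.
by rewrite -[P in RHS]PE mxtrace_mulC RL mxtrace1.
Qed.

Definition sympl_frame k (A B : 'M[R]_(n + n, k)) :=
  [/\ A^T *m Jmx n *m A = 0, B^T *m Jmx n *m B = 0 &
      A^T *m Jmx n *m B = 1%:M].

Lemma sympl_inv_row_mx k (A B : 'M[R]_(n + n, k)) :
  sympl_inv (row_mx A B) = col_mx (- (B^T *m Jmx n)) (A^T *m Jmx n).
Proof.
rewrite /sympl_inv tr_row_mx /Jmx tr_block_mx mul_block_col !trmx0.
rewrite !mul0mx add0r addr0 raddfN /= !trmx1 mulNmx !mul1mx mul_col_mx.
by rewrite mulNmx.
Qed.

Local Notation J := (@Jmx R n).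

Lemma symplectic_form_tr p q (A : 'M[R]_(n + n, p)) (B : 'M[R]_(n + n, q)) :
  B^T *m J *m A = - (A^T *m J *m B)^T.
Proof. by rewrite !trmx_mul trmxK trmx_Jmx mulNmx mulmxN opprK mulmxA. Qed.

Lemma symplectic_form_diag (u : 'cV[R]_(n + n)) : u^T *m J *m u = 0.
Proof.
have h := symplectic_form_tr u u; apply/matrixP => i j; rewrite !ord1 !mxE.
by move/matrixP: h => /(_ 0 0); rewrite !mxE => /eqP; rewrite -addr_eq0
  -mulr2n mulrn_eq0 => /eqP.
Qed.

(** A symplectic basis of the range of [P] is built by splitting off one
    symplectic plane at a time. The form is nondegenerate on the range, since
    [P] is self-adjoint for the form: a vector pairing to [1] with [u] can be
    projected to the range. *)
Lemma sympl_frame_ex k (P : 'M[R]_(n + n)) :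
  P *m P = P -> sympl_inv P = P -> \rank P = (k + k)%N ->
  exists A B : 'M[R]_(n + n, k),
    sympl_frame A B /\ (B *m A^T - A *m B^T) *m J = P.
Proof.
elim: k P => [|k IHk] P PP Pi rP.
  exists 0, 0; split; first by split; apply/matrixP => -[].
  apply/esym/eqP; rewrite !trmx0 !mulmx0 subrr mul0mx -mxrank_eq0.
  by rewrite rP.
have PJ : P^T *m J = J *m P.
  by rewrite -{2}Pi /sympl_inv !mulmxA mulJJt mul1mx.
have [j Pj] : exists j, col j P != 0.
  apply/existsP; apply: contraTT isT => /existsPn P0.
  suff P00 : P = 0 by move: rP; rewrite P00 mxrank0.
  apply/matrixP => i l; have := P0 l; rewrite negbK => /eqP/matrixP/(_ i 0).
  by rewrite !mxE.
set u := col j P in Pj.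
have Pu : P *m u = u by rewrite /u colE mulmxA PP.
have [i ui] : exists i, (u^T *m J) 0 i != 0.
  apply/existsP; apply: contraTT isT => /existsPn u0.
  suff : u^T *m J = 0.
    move=> /(congr1 (fun X => X *m J)) /eqP.
    rewrite mul0mx -mulmxA Jmx_sqr mulmxN mulmx1 oppr_eq0 => /eqP.
    move=> /(congr1 trmx); rewrite trmxK trmx0 => uE.
    by rewrite uE eqxx in Pj.
  apply/matrixP => a b; rewrite ord1 [RHS]mxE.
  by have := u0 b; rewrite negbK => /eqP.
pose w := P *m (((u^T *m J) 0 i)^-1 *: delta_mx i 0 : 'cV[R]_(n + n)).
have Pw : P *m w = w by rewrite /w mulmxA PP.
have formP (v : 'cV[R]_(n + n)) : P *m v = v -> v^T *m J *m P = v^T *m J.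
  by move=> {2}<-; rewrite trmx_mul -!mulmxA PJ.
have uw : u^T *m J *m w = 1%:M.
  rewrite /w mulmxA formP// -scalemxAr -colE; apply/matrixP => a b.
  by rewrite !ord1 mxscaleE [col _ _ _ _]mxE mulVf// [RHS]mxE.
have uu := symplectic_form_diag u; have ww := symplectic_form_diag w.
have wu : w^T *m J *m u = - 1%:M by rewrite symplectic_form_tr uw trmx1.
clearbody u w.
(* The projector onto the plane spanned by [u] and [w]. *)
pose P0 := (w *m u^T - u *m w^T) *m J.
have P0E : P0 = w *m (u^T *m J) - u *m (w^T *m J).
  by rewrite /P0 mulmxBl !mulmxA.
have P0l (x : 'rV[R]_(n + n)) :
    x *m P0 = x *m w *m (u^T *m J) - x *m u *m (w^T *m J).
  by rewrite P0E mulmxBr (mulmxA x w) (mulmxA x u).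
have uP0 : u^T *m J *m P0 = u^T *m J.
  by rewrite P0l uw uu mul1mx mul0mx subr0.
have wP0 : w^T *m J *m P0 = w^T *m J.
  by rewrite P0l ww wu mul0mx add0r mulNmx mul1mx opprK.
have P0P0 : P0 *m P0 = P0.
  by rewrite {1}P0E mulmxBl -(mulmxA w) -(mulmxA u) uP0 wP0 -P0E.
have PP0 : P *m P0 = P0.
  by rewrite P0E mulmxBr (mulmxA P w) (mulmxA P u) Pw Pu.
have P0P : P0 *m P = P0.
  by rewrite P0E mulmxBl -(mulmxA w) -(mulmxA u) !formP.
have P0i : sympl_inv P0 = P0.
  rewrite /sympl_inv {1}/P0 trmx_mul linearB/= !trmx_mul !trmxK mulmxA.
  by rewrite -trmx_mul Jmx_sqr raddfN/= trmx1 mulNmx mul1mx opprB.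
have trP0 : \tr P0 = 2.
  rewrite P0E raddfB/= mxtrace_mulC uw mxtrace_mulC wu raddfN/= mxtrace1.
  by rewrite opprK.
have {}PP1 : (P - P0) *m (P - P0) = P - P0.
  by rewrite mulmxBl !mulmxBr PP PP0 P0P P0P0 subrr subr0.
have P1i : sympl_inv (P - P0) = P - P0.
  by rewrite sympl_invD sympl_invN Pi P0i.
have rP1 : \rank (P - P0) = (k + k)%N.
  apply/eqP; rewrite -(eqr_nat R) mxrank_idem// raddfB/= trP0.
  by rewrite -mxrank_idem// rP addSn addnS -addn2 natrD addrK.
have [A [B [[AA BB AB] P1E]]] := IHk _ PP1 P1i rP1.
have BA : B^T *m J *m A = - 1%:M by rewrite symplectic_form_tr AB trmx1.
have P1form : (P - P0) = B *m (A^T *m J) - A *m (B^T *m J).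
  by rewrite -P1E mulmxBl !mulmxA.
have P1A : (P - P0) *m A = A.
  rewrite P1form mulmxBl -(mulmxA B) -(mulmxA A) AA BA mulmx0 mulmxN mulmx1.
  by rewrite sub0r opprK.
have P1B : (P - P0) *m B = B.
  rewrite P1form mulmxBl -(mulmxA B) -(mulmxA A) AB BB mulmx0 mulmx1.
  by rewrite subr0.
have uP1 : u^T *m J *m (P - P0) = 0 by rewrite mulmxBr formP// uP0 subrr.
have wP1 : w^T *m J *m (P - P0) = 0 by rewrite mulmxBr formP// wP0 subrr.
have uA : u^T *m J *m A = 0 by rewrite -P1A mulmxA uP1 mul0mx.
have uB : u^T *m J *m B = 0 by rewrite -P1B mulmxA uP1 mul0mx.
have wA : w^T *m J *m A = 0 by rewrite -P1A mulmxA wP1 mul0mx.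
have wB : w^T *m J *m B = 0 by rewrite -P1B mulmxA wP1 mul0mx.
(* The dimension [k.+1] must be displayed as a sum for block matrices. *)
suff : exists A' B' : 'M[R]_(n + n, 1 + k),
    sympl_frame A' B' /\ (B' *m A'^T - A' *m B'^T) *m J = P by [].
exists (row_mx u A), (row_mx w B); split; last first.
  rewrite !tr_row_mx !mul_row_col opprD addrACA mulmxDl -/P0.
  by rewrite P1E addrC subrK.
split; rewrite tr_row_mx mul_col_mx mul_col_row.
- rewrite uu uA AA symplectic_form_tr uA trmx0 oppr0.
  by apply/eqP; rewrite block_mx_eq0 !eqxx.
- rewrite ww wB BB symplectic_form_tr wB trmx0 oppr0.
  by apply/eqP; rewrite block_mx_eq0 !eqxx.
- by rewrite uw uB AB symplectic_form_tr wA trmx0 oppr0 -scalar_mx_block.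
Qed.

(** Surjectivity of [rho]: without it the metric [gSpGr] would take its
    default value at some points. *)
Lemma SpGr_rho k (P : 'M[R]_(n + n)) : SpGr R n k P ->
  exists2 U : 'M[R]_(n + n, k + k), SpSt U & rho U = P.
Proof.
move=> [PP rP Pi]; have [A [B [[AA BB AB] <-]]] := sympl_frame_ex PP Pi rP.
have BA : B^T *m J *m A = - 1%:M by rewrite symplectic_form_tr AB trmx1.
exists (row_mx A B).
  rewrite /SpSt/= sympl_inv_row_mx mul_col_row !mulNmx BA BB AA AB.
  by rewrite opprK oppr0 -scalar_mx_block.
rewrite /rho sympl_inv_row_mx mul_row_col mulmxN addrC mulmxBl.
by rewrite !mulmxA.
Qed.

End SymplecticBasis.

(** * The symplectic Grassmannian and its metric *)

Section Orbit.
Context {R : realType} {m : nat}.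
Implicit Types P w : 'M[R]_m.

Lemma is_derive_orbit P w (t : R) :
  is_derive t 1 (fun t : R => expmx (t *: w) *m P *m expmx (t *: - w))
    (lie w (expmx (t *: w) *m P *m expmx (t *: - w))).
Proof.
have lieE (E E' : 'M[R]_m) :
    lie w (E *m P *m E') = w *m E *m P *m E' + E *m P *m (E' *m - w).
  by rewrite /lie !mulmxN !mulmxA.
rewrite lieE; exact: is_derive_mulmx
  (is_derive_mulmxr P (is_derive_expmxl w t)) (is_derive_expmxr (- w) t).
Qed.

Lemma orbit0 P w : expmx (0 *: w) *m P *m expmx (0 *: - w) = P.
Proof. by rewrite !expmx0 mulmx1 mul1mx. Qed.

End Orbit.

Section GrassmannTangent.
Context {R : realType} {n k : nat}.
Implicit Types (P X Y Z w e : 'M[R]_(n + n)).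

Lemma horizontal_hlift (U D : 'M[R]_(n + n, k + k)) :
  SpSt U -> horizontal_space U D ->
  hlift (rho U) (drho U D) = Omega_bar U D.
Proof.
move=> hU hD; have [sw ow] := horizontal_Omega_bar hU hD.
by rewrite -{1}(Omega_bar_mulmx hU D) drho_mulmx// hlift_unique//; exact: rho_idem.
Qed.

(** All representatives [U] of [P] give the same lift, because [hlift] depends
    on [P] only. *)
Lemma gSpGrE P X Y : SpGr R n k P -> grass_tangent P X -> grass_tangent P Y ->
  gSpGr k P X Y = 2^-1 * frob (hlift P X) (hlift P Y).
Proof.
move=> MP tX tY; have [PP _ Pi] := MP; have [U hU UP] := SpGr_rho MP.
rewrite /gSpGr; set A := [set r | _].
have hor Z : grass_tangent P Z -> horizontal_space U (hlift P Z *m U) /\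
    drho U (hlift P Z *m U) = Z.
  move=> tZ; have hZ := hlift_horizontal PP Pi tZ.
  rewrite -UP in hZ *; have [hUZ _] := grass_horizontal_lift hU hZ.
  split=> //; rewrite drho_mulmx; last by case: hZ.
  rewrite UP; case: tZ => _ oZ; by case: (hliftP PP oZ).
have : A (xget 0 A).
  apply: xgetPex; exists (gSpSt U (hlift P X *m U) (hlift P Y *m U)).
  by exists U, (hlift P X *m U), (hlift P Y *m U); split=> //; exact: hor.
move=> [V [D1 [D2 [[hV VP] [hD1 dD1] [hD2 dD2] ->]]]].
have -> : hlift P X = Omega_bar V D1 by rewrite -dD1 -VP horizontal_hlift.
have -> : hlift P Y = Omega_bar V D2 by rewrite -dD2 -VP horizontal_hlift.
have [sw1 _] := horizontal_Omega_bar hV hD1.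
have [sw2 _] := horizontal_Omega_bar hV hD2.
by have := gSpStE hV sw1 sw2; rewrite !Omega_bar_mulmx.
Qed.

(** The curve [sympl_inv (expmx (t *: w)) *m expmx (t *: w)] has zero
    derivative, so that the exponential is symplectic. *)
Lemma sympl_inv_expmx w (t : R) : sp_algebra w ->
  sympl_inv (expmx (t *: w)) = expmx (t *: - w).
Proof.
move=> sw.
have dv (X : R -> 'M[R]_(n + n)) (s : R) : is_derive s 1 X (w *m X s) ->
    is_derive s 1 (fun t => sympl_inv (X t) *m X t) 0.
  move=> dX; have := is_derive_mulmx (is_derive_sympl_inv dX) dX.
  by rewrite (sympl_invM w) sw mulmxN mulNmx mulmxA addNr.
have := is_derive_mx0_cst (fun s => dv _ s (is_derive_expmxl w s)) t.
rewrite expmx0 sympl_inv1 mulmx1 => h.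
by rewrite -[LHS]mulmx1 -(expmxNr w t) mulmxA h mul1mx.
Qed.

Lemma SpGr_conj P (A A' : 'M[R]_(n + n)) : A' *m A = 1%:M ->
  sympl_inv A = A' -> SpGr R n k P -> SpGr R n k (A *m P *m A').
Proof.
move=> A'A Ai [PP rP Pi].
have uA : A \in unitmx by case/mulmx1_unit: A'A.
have uA' : A' \in unitmx by case/mulmx1_unit: A'A.
split.
- have assoc (B1 B2 B3 B4 : 'M[R]_(n + n)) :
      B1 *m B2 *m B3 *m (B4 *m B2 *m B3) = B1 *m B2 *m (B3 *m B4) *m B2 *m B3.
    by rewrite !mulmxA.
  by rewrite assoc A'A mulmx1 -(mulmxA A) PP.
- by rewrite mxrankMfree ?row_free_unit// eqmxMfull ?row_full_unit.
- by rewrite sympl_invM (sympl_invM A) Pi Ai -Ai sympl_invK Ai mulmxA.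
Qed.

Lemma orbit_SpGr P w : SpGr R n k P -> sp_algebra w ->
  smooth_curve_in (SpGr R n k)
    (fun t : R => expmx (t *: w) *m P *m expmx (t *: - w)).
Proof.
move=> MP sw; split=> [|t]; last first.
  by apply: SpGr_conj => //; [exact: expmxNl | exact: sympl_inv_expmx].
have sE := smooth_expmx w; have sE' := smooth_expmx (- w).
have sP : smooth_curve (fun=> P : 'M[R]_(n + n)) by exact: smooth_cst.
have sEP := smooth_mulmx sE sP.
exact: (smooth_mulmx sEP sE').
Qed.

Lemma velocity_tangent (gamma : R -> 'M[R]_(n + n)) (t : R) :
  smooth_curve_in (SpGr R n k) gamma ->
  grass_tangent (gamma t) (gamma^`()%classic t).
Proof.
move=> [sg Mg]; have dg := smooth_is_derive t sg; split.
  rewrite -(derive1_val (is_derive_sympl_inv dg)).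
  by congr (derive1 _ t); apply/funext => s; case: (Mg s).
have := derive1_val (is_derive_mulmx dg dg); rewrite /offdiag addrC => <-.
by congr (derive1 _ t); apply/funext => s; case: (Mg s).
Qed.

(** A solution of the linearized equations is the velocity of an orbit of the
    symplectic group, generated by [lie X P]. *)
Lemma tangent_SpGrP P X : SpGr R n k P ->
  tangent_space (SpGr R n k) P X <-> grass_tangent P X.
Proof.
move=> MP; have [PP _ Pi] := MP; split.
  by move=> [gamma [sg <- <-]]; exact: velocity_tangent.
move=> [Xi oX].
have sw : sp_algebra (lie X P) by rewrite /sp_algebra/= sympl_inv_lie Xi Pi lieC.
exists (fun t : R => expmx (t *: lie X P) *m P *m expmx (t *: - lie X P)); split.
- exact: orbit_SpGr.
- exact: orbit0.
- by rewrite (derive1_val (is_derive_orbit P _ 0)) orbit0 lie_lieK.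
Qed.

Lemma hlift_lie P X : SpGr R n k P -> grass_tangent P X ->
  lie (hlift P X) P = X.
Proof. by move=> [PP _ _] [_ oX]; have [] := hliftP PP oX. Qed.

End GrassmannTangent.

(** * The Levi-Civita connection of the Grassmannian *)

Section GrassmannConnection.
Context {R : realType} {n k : nat}.
Implicit Types (P X Y Z w e z : 'M[R]_(n + n)) (gamma : R -> 'M[R]_(n + n)).

Local Notation M := (SpGr R n k).

(** The Koszul formula for the right-invariant metric [frob] on a matrix group
    whose Lie algebra is closed under transposition: the adjoint of [lie w] is
    [lie w^T]. *)
Definition koszul w e := 2^-1 *: (lie w^T e + lie e^T w - lie w e).

Lemma koszulZl a w1 w2 e :
  koszul (a *: w1 + w2) e = a *: koszul w1 e + koszul w2 e.
Proof.
rewrite /koszul linearP/= (lieDl (a *: w1^T)) (lieZl a) (lieDr (a *: w1)).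
by rewrite (lieZr a) (lieDl (a *: w1)) (lieZl a w1); mxlin.
Qed.

Lemma koszul_sym w e : koszul w e = koszul e w + lie e w.
Proof.
rewrite /koszul [lie w e]lieC; move: (lie w^T e) (lie e^T w) (lie e w).
by move=> a b c; apply/matrixP => i j;
  rewrite !(mxaddE, mxscaleE, mxoppE); field.
Qed.

Lemma koszul_self w : koszul w w = lie w^T w.
Proof.
rewrite /koszul {3}/lie subrr subr0; move: (lie w^T w) => a.
by apply/matrixP => i j; rewrite !(mxaddE, mxscaleE); field.
Qed.

(** This is the compatibility of the connection with the metric, as far as it
    involves no derivative. *)
Lemma koszul_skew w e z : frob (koszul w e) z + frob e (koszul w z) = 0.
Proof.
have frobE3 (A B C X : 'M[R]_(n + n)) : frob (2^-1 *: (A + B - C)) X =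
    2^-1 * (frob A X + frob B X - frob C X).
  by rewrite frobZl frobDl frobDl frobNl.
rewrite [frob e _]frobC /koszul !frobE3.
rewrite (frob_lie w^T e) (frob_lie w e) (frob_lie e^T) (frob_lie z^T) !trmxK.
rewrite (lieC z e) frobNr (frobC e) (frobC e); ring.
Qed.

Lemma sp_koszul w e : sp_algebra w -> sp_algebra e -> sp_algebra (koszul w e).
Proof.
move=> sw se; have swT := sp_algebra_tr sw; have seT := sp_algebra_tr se.
apply/sp_algebraZ/sp_algebraB; last exact: sp_algebra_lie.
by apply: sp_algebraD; exact: sp_algebra_lie.
Qed.

(** The first term is the Koszul formula for the lifts; the second one
    compensates for the derivative of [P] in [Y = lie e P], so that no
    derivative of [hlift] occurs. *)
Definition grass_christoffel P X Y :=
  let w := hlift P X in let e := hlift P Y in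
  lie (koszul w e) P - lie e (lie w P).

Section AlongCurve.
Variables (gamma Y : R -> 'M[R]_(n + n)).
Hypothesis sgamma : smooth_curve_in M gamma.
Hypothesis sY : smooth_curve Y.
Hypothesis tY : forall t, grass_tangent (gamma t) (Y t).

Let w t := hlift (gamma t) (gamma^`()%classic t).
Let eta t := hlift (gamma t) (Y t).

Let idem t : gamma t *m gamma t = gamma t.
Proof. by case: sgamma => _ /(_ t) []. Qed.

Let symp t : sympl_inv (gamma t) = gamma t.
Proof. by case: sgamma => _ /(_ t) []. Qed.

Lemma smooth_lift : smooth_curve eta.
Proof. by case: sgamma => sg _; exact: smooth_hlift idem sg sY. Qed.

Lemma smooth_velocity_lift : smooth_curve w.
Proof.
by case: sgamma => sg _; exact: smooth_hlift idem sg (smooth_derive1 sg).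
Qed.

Lemma velocityE t : gamma^`()%classic t = lie (w t) (gamma t).
Proof.
case: (sgamma) => _ Mg.
by rewrite /w (hlift_lie (Mg t) (velocity_tangent t sgamma)).
Qed.

Lemma sp_lift t : sp_algebra (eta t).
Proof. by have [] := hlift_horizontal (idem t) (symp t) (tY t). Qed.

Lemma sp_velocity_lift t : sp_algebra (w t).
Proof.
by have [] := hlift_horizontal (idem t) (symp t) (velocity_tangent t sgamma).
Qed.

Lemma sp_derive_lift t : sp_algebra (eta^`()%classic t).
Proof.
have de := smooth_is_derive t smooth_lift.
rewrite /sp_algebra/= -(derive1_val (is_derive_sympl_inv de)).
rewrite -(derive1_val (is_deriveN de)).
by congr (derive1 _ t); apply/funext => s; exact: sp_lift.
Qed.

(** In terms of the lift, covariant differentiation is that of the Lie group,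
    projected to the Grassmannian by the infinitesimal action. *)
Lemma covariant_derivativeE t :
  covariant_derivative grass_christoffel gamma Y t =
  lie (eta^`()%classic t + koszul (w t) (eta t)) (gamma t).
Proof.
case: (sgamma) => sg Mg; rewrite /covariant_derivative.
have de := smooth_is_derive t smooth_lift.
have dg := smooth_is_derive t sg.
have YE : Y = (fun s => lie (eta s) (gamma s)).
  by apply/funext => s; rewrite /eta (hlift_lie (Mg s) (tY s)).
rewrite {1}YE (derive1_val (is_derive_lie de dg)) /grass_christoffel.
rewrite -/(w t) -/(eta t) velocityE (lieDl (eta^`()%classic t)).
by rewrite addrACA [X in _ + X]addrC -addrA addNr addr0 addrC.
Qed.

Lemma smooth_covariant_derivative :
  smooth_curve (covariant_derivative grass_christoffel gamma Y).
Proof.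
case: (sgamma) => sg _.
rewrite (_ : covariant_derivative _ _ _ =
  fun t => lie (eta^`()%classic t + koszul (w t) (eta t)) (gamma t)); last first.
  by apply/funext => t; exact: covariant_derivativeE.
have se := smooth_lift; have sw := smooth_velocity_lift.
apply: smooth_lie sg; apply: smoothD (smooth_derive1 se) _.
apply: smoothZ; apply: smoothB (smooth_lie sw se).
exact: smoothD (smooth_lie (smooth_trmx sw) se)
  (smooth_lie (smooth_trmx se) sw).
Qed.

Lemma sp_covariant_lift t :
  sp_algebra (eta^`()%classic t + koszul (w t) (eta t)).
Proof.
apply: sp_algebraD; first exact: sp_derive_lift.
by apply: sp_koszul; [exact: sp_velocity_lift | exact: sp_lift].
Qed.

Lemma covariant_derivative_tangent t :
  grass_tangent (gamma t) (covariant_derivative grass_christoffel gamma Y t).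
Proof.
rewrite covariant_derivativeE.
exact: grass_tangent_lie (idem t) (symp t) (sp_covariant_lift t).
Qed.

End AlongCurve.

(** Lifting [lie w P] amounts to the orthogonal projection of [w] to the
    horizontal space: the difference commutes with [P]. *)
Lemma frob_hlift_lie P w z : SpGr R n k P -> grass_horizontal P z ->
  frob (hlift P (lie w P)) z = frob w z.
Proof.
move=> [PP _ _] [_ oz]; have [_ hE] := hliftP PP (offdiag_lie PP w).
apply/eqP; rewrite -subr_eq0 -frobNl -frobDl; apply/eqP.
apply: frob_commutant oz => //.
by rewrite (lieDl (hlift _ _)) lieNl hE subrr.
Qed.

Lemma gSpGr_liel P w Z : M P -> sp_algebra w -> grass_tangent P Z ->
  gSpGr k P (lie w P) Z = 2^-1 * frob w (hlift P Z).
Proof.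
move=> MP sw tZ; have [PP _ Pi] := MP.
rewrite (gSpGrE MP (grass_tangent_lie PP Pi sw) tZ).
by rewrite (frob_hlift_lie w MP (hlift_horizontal PP Pi tZ)).
Qed.

Lemma gSpGr_lier P w Z : M P -> sp_algebra w -> grass_tangent P Z ->
  gSpGr k P Z (lie w P) = 2^-1 * frob (hlift P Z) w.
Proof.
move=> MP sw tZ; have [PP _ Pi] := MP.
rewrite (gSpGrE MP tZ (grass_tangent_lie PP Pi sw)) frobC.
by rewrite (frob_hlift_lie w MP (hlift_horizontal PP Pi tZ)) frobC.
Qed.

End GrassmannConnection.

Section GrassmannGeodesics.
Context {R : realType} {n k : nat}.
Implicit Types (P X Y Z w e z : 'M[R]_(n + n)).
Implicit Types (gamma : R -> 'M[R]_(n + n)) (t : R).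

Local Notation M := (SpGr R n k).
Local Notation g := (@gSpGr R n k).

Lemma hliftB P X Y : hlift P (X - Y) = hlift P X - hlift P Y.
Proof.
by rewrite -(scaleN1r Y) addrC hlift_is_linear scaleN1r addrC.
Qed.

Lemma grass_tangentB P X Y :
  grass_tangent P X -> grass_tangent P Y -> grass_tangent P (X - Y).
Proof.
move=> [Xi oX] [Yi oY]; split; last exact: offdiagB.
by rewrite sympl_invD sympl_invN Xi Yi.
Qed.

Lemma vector_field_tangent gamma (Y : R -> 'M[R]_(n + n)) t : smooth_curve_in M gamma ->
  vector_field_along M gamma Y -> grass_tangent (gamma t) (Y t).
Proof. by move=> [_ Mg] [_ tY]; apply/(tangent_SpGrP _ (Mg t)). Qed.

(** Symmetry is the Jacobi identity, and compatibility is [koszul_skew]. *)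
Lemma levi_civita_christoffel : levi_civita M g grass_christoffel.
Proof.
split.
- move=> P _ a X Y Z _ _ _; rewrite /grass_christoffel hlift_is_linear koszulZl.
  rewrite (lieDl (a *: koszul _ _)) (lieZl a (koszul _ _)).
  rewrite (lieDl (a *: hlift P X)) (lieZl a (hlift P X)).
  rewrite (lieDr (a *: lie _ _)) (lieZr a (lie (hlift P X) P)).
  have AC (x y u v : 'M[R]_(n + n)) :
      a *: x + y - (a *: u + v) = a *: (x - u) + (y - v).
    by rewrite scalerBr opprD addrACA.
  exact: AC.
- move=> P _ X Y _ _; rewrite /grass_christoffel.
  move: (hlift P X) (hlift P Y) => w e.
  rewrite koszul_sym (lieDl (koszul e w)) (lie_jacobi e w).
  have AC (x y z : 'M[R]_(n + n)) : x + (y - z) - y = x - z by mxlin.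
  exact: AC.
- move=> gamma Y sg fY; have tY t := vector_field_tangent t sg fY.
  split; first exact: smooth_covariant_derivative sg fY.1 tY.
  move=> t; apply/(tangent_SpGrP _ (sg.2 t)).
  exact: covariant_derivative_tangent sg fY.1 tY t.
move=> gamma Y Z sg fY fZ t.
have tY s := vector_field_tangent s sg fY.
have tZ s := vector_field_tangent s sg fZ.
have dY := smooth_is_derive t (smooth_lift sg fY.1).
have dZ := smooth_is_derive t (smooth_lift sg fZ.1).
rewrite (_ : (fun s => _) = 2^-1 \*: (fun s =>
    frob (hlift (gamma s) (Y s)) (hlift (gamma s) (Z s)))); last first.
  by apply/funext => s; exact: gSpGrE (sg.2 s) (tY s) (tZ s).
have sY : sp_algebra _ := sp_covariant_lift sg fY.1 tY t.
have sZ : sp_algebra _ := sp_covariant_lift sg fZ.1 tZ t.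
rewrite (covariant_derivativeE sg fY.1 tY) (covariant_derivativeE sg fZ.1 tZ).
rewrite (gSpGr_liel (sg.2 t) sY (tZ t)) (gSpGr_lier (sg.2 t) sZ (tY t)) -mulrDr.
have frobE (A B C D E F : 'M[R]_(n + n)) : frob B C + frob D F = 0 ->
    frob (A + B) C + frob D (E + F) = frob A C + frob D E.
  by move=> BC; rewrite frobDl frobDr addrACA BC addr0.
rewrite frobE; last exact: koszul_skew.
exact: is_deriveZ (is_derive_frob dY dZ).
Qed.

Lemma sp_lie_tangent P X : SpGr R n k P -> grass_tangent P X ->
  sp_algebra (hlift P X).
Proof. by move=> [PP _ Pi] tX; have [] := hlift_horizontal PP Pi tX. Qed.

Lemma sym_skew_tensor_eq0 (T : Type) (D : T -> Prop) (b : T -> T -> T -> R) :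
  (forall x y z : T, D x -> D y -> D z -> b x y z = - b x z y) ->
  (forall x y z : T, D x -> D y -> D z -> b x y z = b y x z) ->
  forall x y z : T, D x -> D y -> D z -> b x y z = 0.
Proof.
move=> skew sym x y z Dx Dy Dz.
have : b x y z = - b x y z.
  rewrite {1}skew// (sym x z)// (skew z x y)// opprK (sym z y x)//.
  by rewrite (skew y z x)// (sym y x z).
by move/eqP; rewrite -addr_eq0 -mulr2n mulrn_eq0 => /eqP.
Qed.

(** The difference [S] of two Levi-Civita connections is symmetric by the
    vanishing of the torsion, and skew for the metric by compatibility; such
    a tensor is zero. Compatibility is tested at [P] on the fields
    [lie e sigma], with constant [e], along an orbit [sigma] through [P]. *)
Lemma levi_civita_unique Gam P X Y : levi_civita M g Gam -> SpGr R n k P ->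
  grass_tangent P X -> grass_tangent P Y ->
  Gam P X Y = grass_christoffel P X Y.
Proof.
move=> LC MP; have [PP _ Pi] := MP; have tP := tangent_SpGrP _ MP.
have LC' := levi_civita_christoffel.
pose S X Y := Gam P X Y - grass_christoffel P X Y.
pose h := hlift P.
have key X' Y' Z' : grass_tangent P X' -> grass_tangent P Y' ->
    grass_tangent P Z' -> grass_tangent P (S X' Y') /\
    frob (h (S X' Y')) (h Z') + frob (h Y') (h (S X' Z')) = 0.
  move=> tX tY tZ; have sw := sp_lie_tangent MP tX.
  pose sigma := fun t : R =>
    expmx (t *: h X') *m P *m expmx (t *: - h X').
  have ss : smooth_curve_in M sigma := orbit_SpGr MP sw.
  have s0 : sigma 0 = P := orbit0 P (h X').
  have ds : sigma^`()%classic 0 = X'.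
    by rewrite (derive1_val (is_derive_orbit P _ 0)) orbit0 (hlift_lie MP tX).
  have field V : grass_tangent P V ->
      vector_field_along M sigma (fun t => lie (h V) (sigma t)).
    move=> tV; split.
      have sV := smooth_cst (h V : 'M[R]_(n + n)).
      exact: smooth_lie sV ss.1.
    move=> t; apply/(tangent_SpGrP _ (ss.2 t)); have [ss2 _ ssi] := ss.2 t.
    by apply: grass_tangent_lie => //; exact: sp_lie_tangent.
  have field0 V : grass_tangent P V -> lie (h V) (sigma 0) = V.
    by move=> tV; rewrite s0 (hlift_lie MP tV).
  have covE G V : grass_tangent P V ->
      covariant_derivative G sigma (fun t => lie (h V) (sigma t)) 0 =
      (fun t => lie (h V) (sigma t))^`()%classic 0 + G P X' V.
    by move=> tV; rewrite /covariant_derivative ds (field0 V tV) s0.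
  pose cov G V := covariant_derivative G sigma (fun t => lie (h V) (sigma t)) 0.
  have SE V : grass_tangent P V ->
      S X' V = cov Gam V - cov grass_christoffel V.
    move=> tV; rewrite /cov (covE Gam V tV) (covE grass_christoffel V tV) /S.
    move: (_^`()%classic 0) (Gam P X' V) (grass_christoffel P X' V) => x y z.
    by mxlin.
  have tcov G V : levi_civita M g G -> grass_tangent P V ->
      grass_tangent P (cov G V).
    move=> [_ _ F _] tV; have [_ /(_ 0)] := F _ _ ss (field _ tV).
    by rewrite s0 => /tP.
  split; first by rewrite SE//; apply: grass_tangentB; exact: tcov.
  have gcov G : levi_civita M g G ->
      is_derive (0 : R) 1
        (fun s => g (sigma s) (lie (h Y') (sigma s)) (lie (h Z') (sigma s)))
        (2^-1 * (frob (h (cov G Y')) (h Z') + frob (h Y') (h (cov G Z')))).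
    move=> LG; have [_ _ _ F] := LG.
    have := F _ _ _ ss (field _ tY) (field _ tZ) 0.
    rewrite s0 -s0 (field0 Y' tY) (field0 Z' tZ) s0 -/(cov G Y') -/(cov G Z').
    rewrite (gSpGrE MP (tcov G Y' LG tY) tZ) (gSpGrE MP tY (tcov G Z' LG tZ)).
    by rewrite -mulrDr.
  have two0 : (2^-1 : R) != 0 by rewrite invr_eq0 pnatr_eq0.
  have e := etrans (esym (derive1_val (gcov _ LC))) (derive1_val (gcov _ LC')).
  have {}e := mulfI two0 e.
  have fin (x1 x2 y z1 z2 z : 'M[R]_(n + n)) :
      frob x1 z + frob y z1 = frob x2 z + frob y z2 ->
      frob (x1 - x2) z + frob y (z1 - z2) = 0.
    by move=> E; rewrite frobDl frobDr frobNl frobNr addrACA -opprD E subrr.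
  have hSE V : grass_tangent P V ->
      h (S X' V) = h (cov Gam V) - h (cov grass_christoffel V).
    by move=> tV; rewrite (SE V tV); exact: hliftB.
  apply: etrans (fin _ _ _ _ _ _ e).
  exact: congr2 (congr2 (@frob R _ _) (hSE Y' tY) erefl)
    (congr2 (@frob R _ _) erefl (hSE Z' tZ)).
have Ssym X' Y' : grass_tangent P X' -> grass_tangent P Y' -> S X' Y' = S Y' X'.
  move=> tX tY; have [_ sG _ _] := LC; have [_ sG' _ _] := LC'.
  have [hX hY] := ((tP _).2 tX, (tP _).2 tY).
  by rewrite /S (sG P MP X' Y' hX hY) (sG' P MP X' Y' hX hY).
move=> tX tY; apply/eqP; rewrite -subr_eq0 -/(S X Y); apply/eqP.
have [tS _] := key X Y X tX tY tX.
rewrite -(hlift_lie MP tS) -/h (_ : h (S X Y) = 0) ?lie0l//.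
pose b X Y Z := frob (h (S X Y)) (h Z).
have bskew X' Y' Z' : grass_tangent P X' -> grass_tangent P Y' ->
    grass_tangent P Z' -> b X' Y' Z' = - b X' Z' Y'.
  move=> t1 t2 t3; have [_ /eqP] := key _ _ _ t1 t2 t3.
  by rewrite addr_eq0 (frobC (h Y')) => /eqP.
have bsym X' Y' Z' : grass_tangent P X' -> grass_tangent P Y' ->
    grass_tangent P Z' -> b X' Y' Z' = b Y' X' Z'.
  by move=> t1 t2 _; rewrite /b (Ssym X' Y' t1 t2).
exact: frob_eq0
  (@sym_skew_tensor_eq0 _ (grass_tangent P) b bskew bsym X Y (S X Y) tX tY tS).
Qed.

(** * The geodesic equation *)

Section Geodesic.
Variable gamma : R -> 'M[R]_(n + n).
Hypothesis sgamma : smooth_curve_in M gamma.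

Let w t := hlift (gamma t) (gamma^`()%classic t).

Lemma smooth_geodesic_lift : smooth_curve w.
Proof. exact: smooth_velocity_lift sgamma. Qed.

Lemma velocity_covariant_derivative t :
  covariant_derivative grass_christoffel gamma gamma^`()%classic t =
  lie (w^`()%classic t + lie (w t)^T (w t)) (gamma t).
Proof.
have tg s := velocity_tangent s sgamma.
have sg := smooth_derive1 sgamma.1.
by rewrite (covariant_derivativeE sgamma sg tg) koszul_self.
Qed.

(** The derivative of the horizontality of [w] along the curve, in which the
    derivative of [gamma] is expressed by [w] itself. *)
Lemma offdiag_derive_lift t :
  offdiag (gamma t)^T (w^`()%classic t + lie (w t)^T (w t)).
Proof.
have dg := is_derive_trmx (smooth_is_derive t sgamma.1).
have dw := smooth_is_derive t smooth_geodesic_lift.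
have ow s : offdiag (gamma s)^T (w s).
  have [PP _ Pi] := sgamma.2 s.
  by have [] := hlift_horizontal PP Pi (velocity_tangent s sgamma).
have dgE : (gamma^`()%classic t)^T = - lie (w t)^T (gamma t)^T.
  by rewrite -trmx_lie -(velocityE sgamma t).
have := derive1_val (is_deriveD (is_derive_mulmx dg dw) (is_derive_mulmx dw dg)).
have -> : (fun s => (gamma s)^T *m w s) + (fun s => w s *m (gamma s)^T) = w.
  by apply/funext => s; exact: ow.
rewrite dgE; have : lie (w t)^T (w t) =
    lie (w t)^T (gamma t)^T *m w t + (gamma t)^T *m lie (w t)^T (w t) +
    (lie (w t)^T (w t) *m (gamma t)^T + w t *m lie (w t)^T (gamma t)^T).
  by rewrite -lie_derivation -lie_derivation -lieDr ow.
rewrite /offdiag.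
move: (lie (w t)^T (w t)) (lie (w t)^T (gamma t)^T) (w^`()%classic t) => l q v.
move=> lE; rewrite !mulNmx !mulmxN => vE.
rewrite [in RHS]vE [in RHS]lE !mulmxDr !mulmxDl.
move: (gamma t)^T (w t) => p x; mxlin.
Qed.

(** The geodesic equation says that [w' + lie w^T w] commutes with [gamma]; as
    this matrix is also horizontal, it is zero. This is the Euler-Poincare
    equation of the right-invariant metric. *)
Lemma geodesic_lift_eq : geodesic M g gamma <->
  forall t, is_derive t 1 w (lie (w t) (w t)^T).
Proof.
split=> [[_ [Gam LC cov0]] t|dw].
  have dw := smooth_is_derive t smooth_geodesic_lift.
  suff dE : w^`()%classic t + lie (w t)^T (w t) = 0.
    by move/eqP: dE; rewrite addr_eq0 -lieC => /eqP <-.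
  have [PP _ _] := sgamma.2 t.
  apply: (offdiag_tr_lie_eq0 PP (offdiag_derive_lift t)).
  rewrite -velocity_covariant_derivative -(cov0 t).
  have tg := velocity_tangent t sgamma.
  by rewrite /covariant_derivative (levi_civita_unique LC (sgamma.2 t) tg tg).
split=> //; exists grass_christoffel; first exact: levi_civita_christoffel.
move=> t; rewrite velocity_covariant_derivative (derive1_val (dw t)).
by rewrite [lie (w t) _]lieC addNr lie0l.
Qed.

End Geodesic.

End GrassmannGeodesics.

(** * The lifted geodesics *)

Section GeodesicFlow.
Context {R : realType} {m : nat}.
Variable W : 'M[R]_m.
Implicit Types t : R.

Let A := W - W^T.

(** The geodesic from the identity with initial velocity [W] of the
    right-invariant metric [frob] on the general linear group. *)
Definition flow t := expmx (t *: A) *m expmx (t *: W^T).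

Definition flow_inv t := expmx (t *: - W^T) *m expmx (t *: - A).

(** The right logarithmic derivative of [flow]. *)
Definition flow_velocity t := expmx (t *: A) *m W *m expmx (t *: - A).

Lemma mulmx_inv_comp (X X' Y Y' : 'M[R]_m) :
  X' *m X = 1%:M -> Y' *m Y = 1%:M -> (Y' *m X') *m (X *m Y) = 1%:M.
Proof. by move=> XX YY; rewrite mulmxA -(mulmxA Y') XX mulmx1. Qed.

Lemma flowVK t : flow_inv t *m flow t = 1%:M.
Proof. exact: mulmx_inv_comp (expmxNl A t) (expmxNl W^T t). Qed.

Lemma flowKV t : flow t *m flow_inv t = 1%:M.
Proof. exact: mulmx_inv_comp (expmxNr W^T t) (expmxNr A t). Qed.

Lemma flow0 : flow 0 = 1%:M.
Proof. by rewrite /flow !expmx0 mulmx1. Qed.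

Lemma flow_inv0 : flow_inv 0 = 1%:M.
Proof. by rewrite /flow_inv !expmx0 mulmx1. Qed.

Lemma flow_velocity0 : flow_velocity 0 = W.
Proof. by rewrite /flow_velocity !expmx0 mulmx1 mul1mx. Qed.

Lemma smooth_flow : smooth_curve flow.
Proof. exact: smooth_mulmx (smooth_expmx A) (smooth_expmx W^T). Qed.

Lemma is_derive_flow t : is_derive t 1 flow (flow_velocity t *m flow t).
Proof.
have -> : flow_velocity t *m flow t = A *m expmx (t *: A) *m expmx (t *: W^T) +
    expmx (t *: A) *m (W^T *m expmx (t *: W^T)).
  have e2 := expmxNl A t; have e1 := expmx_comm A t.
  rewrite /flow_velocity /flow; move: e1 e2.
  move: (expmx (t *: A)) (expmx (t *: - A)) (expmx (t *: W^T)) => E E' F e1 e2.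
  rewrite mulmxA -(mulmxA (E *m W)) e2 mulmx1 e1 mulmxA -mulmxDl -mulmxDr.
  by rewrite /A subrK.
exact: is_derive_mulmx (is_derive_expmxl A t) (is_derive_expmxl W^T t).
Qed.

Lemma is_derive_flow_inv t :
  is_derive t 1 flow_inv (- (flow_inv t *m flow_velocity t)).
Proof.
have -> : - (flow_inv t *m flow_velocity t) =
    expmx (t *: - W^T) *m (- W^T) *m expmx (t *: - A) +
    expmx (t *: - W^T) *m (- A *m expmx (t *: - A)).
  have e2 := expmxNl A t; rewrite /flow_velocity /flow_inv; move: e2.
  move: (expmx (t *: A)) (expmx (t *: - A)) (expmx (t *: - W^T)) => E E' F e2.
  rewrite !mulmxA -(mulmxA F E') e2 mulmx1 -mulmxDl -mulmxDr.
  by rewrite /A opprB addKr mulmxN mulNmx.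
exact: is_derive_mulmx (is_derive_expmxr (- W^T) t) (is_derive_expmxl (- A) t).
Qed.

Lemma is_derive_flow_velocity t :
  is_derive t 1 flow_velocity (lie A (flow_velocity t)).
Proof. exact: is_derive_orbit. Qed.

Let AT : A^T = - A.
Proof. by rewrite /A linearB/= trmxK opprB. Qed.

Lemma trmx_flow_velocity t :
  (flow_velocity t)^T = expmx (t *: A) *m W^T *m expmx (t *: - A).
Proof.
have e1 := trmx_expmx A t; have e2 := trmx_expmx (- A) t; move: e1 e2.
have -> : (- A)^T = A by rewrite raddfN/= AT opprK.
rewrite AT /flow_velocity; move: (expmx (t *: A)) (expmx (t *: - A)) => E E'.
by move=> e1 e2; rewrite !trmx_mul e1 e2 mulmxA.
Qed.

(** The transposed velocity is transported by the flow, as the projector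
    [rho (flow t *m U)] is; hence the flow preserves horizontality. *)
Lemma flow_velocity_trE t :
  (flow_velocity t)^T = flow t *m W^T *m flow_inv t.
Proof.
rewrite trmx_flow_velocity /flow /flow_inv.
have e2 := expmxNr W^T t; have e1 := expmx_comm W^T t; move: e1 e2.
move: (expmx (t *: A)) (expmx (t *: - A)) (expmx (t *: W^T))
  (expmx (t *: - W^T)) => E E' F F' e1 e2.
by rewrite !mulmxA -(mulmxA E F) -e1 mulmxA -(mulmxA (E *m W^T)) e2 mulmx1.
Qed.

Lemma flow_velocity_skew t : flow_velocity t - (flow_velocity t)^T = A.
Proof.
rewrite trmx_flow_velocity /flow_velocity -mulmxBl -mulmxBr -/A.
by rewrite -expmx_comm -mulmxA expmxNr mulmx1.
Qed.

Lemma lie_skew_part (w : 'M[R]_m) : lie (w - w^T) w = lie w w^T.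
Proof. by rewrite /lie; mxexpand; mxlin. Qed.

(** The skew part of a solution of [w' = lie w w^T] is constant, so that the
    equation becomes linear. *)
Lemma euler_poincare_unique (w : R -> 'M[R]_m) :
  (forall t, is_derive t 1 w (lie (w t) (w t)^T)) -> w 0 = W ->
  forall t, w t = flow_velocity t.
Proof.
move=> dw w0.
have wA t : w t - (w t)^T = A.
  have dv (s : R) : is_derive s 1 (fun s => w s - (w s)^T) 0.
    have := is_deriveB (dw s) (is_derive_trmx (dw s)).
    by rewrite trmx_lie trmxK -lieC subrr.
  by rewrite (is_derive_mx0_cst dv t) w0.
have {}dw (s : R) : is_derive s 1 w (lie A (w s)).
  by rewrite -(wA s) lie_skew_part.
have dv (s : R) : is_derive s 1
    (fun s => expmx (s *: - A) *m w s *m expmx (s *: A)) 0.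
  have := is_derive_mulmx (is_derive_mulmx (is_derive_expmxr (- A) s) (dw s))
    (is_derive_expmxl A s).
  have -> : (expmx (s *: - A) *m - A *m w s + expmx (s *: - A) *m lie A (w s))
      *m expmx (s *: A) + expmx (s *: - A) *m w s *m (A *m expmx (s *: A)) = 0.
    move: (expmx (s *: A)) (expmx (s *: - A)) (w s) A => E E' X B.
    by rewrite /lie; mxexpand; mxlin.
  by [].
move=> t; have := is_derive_mx0_cst dv t.
rewrite !expmx0 mulmx1 mul1mx w0 /flow_velocity => <-.
have := expmxNr A t; move: (expmx (t *: A)) (expmx (t *: - A)) => E E' e.
by rewrite !mulmxA e mul1mx -mulmxA e mulmx1.
Qed.

End GeodesicFlow.

Section LiftedGeodesic.
Context {R : realType} {n k : nat}.

Lemma is_derive_rho_curve (c : R -> 'M[R]_(n + n, k + k)) (t : R) dc :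
  is_derive t 1 c dc -> is_derive t 1 (rho \o c) (drho (c t) dc).
Proof.
by move=> dv; rewrite drhoE; exact: is_derive_mulmx dv (is_derive_sympl_inv dv).
Qed.

Lemma smooth_rho (c : R -> 'M[R]_(n + n, k + k)) :
  smooth_curve c -> smooth_curve (rho \o c).
Proof. by move=> sc; exact: smooth_mulmx sc (smooth_sympl_inv sc). Qed.

Variables (U Delta : 'M[R]_(n + n, k + k)).
Hypothesis hU : SpSt U.
Hypothesis hDelta : horizontal_space U Delta.

Let W := Omega_bar U Delta.

Let hW : grass_horizontal (rho U) W.
Proof. exact: horizontal_Omega_bar. Qed.

Lemma sympl_inv_flow (t : R) : sympl_inv (flow W t) = flow_inv W t.
Proof.
have [sW _] := hW; have sWT := sp_algebra_tr sW.
rewrite /flow (sympl_invM (expmx (t *: (W - W^T)))).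
by rewrite !sympl_inv_expmx//; exact: sp_algebraB.
Qed.

Lemma SpSt_flow (t : R) : SpSt (flow W t *m U).
Proof.
rewrite /SpSt/= (sympl_invM (flow W t)) sympl_inv_flow mulmxA.
by rewrite -(mulmxA _ (flow_inv W t)) flowVK mulmx1; exact: hU.
Qed.

Lemma rho_flow (t : R) :
  rho (flow W t *m U) = flow W t *m rho U *m flow_inv W t.
Proof.
rewrite {1}/rho (sympl_invM (flow W t)) sympl_inv_flow.
by rewrite (mulmxA _ (sympl_inv U)) -(mulmxA _ U).
Qed.

Lemma flow_velocity_horizontal (t : R) :
  grass_horizontal (rho (flow W t *m U)) (flow_velocity W t).
Proof.
have [sW oW] := hW; have sWT := sp_algebra_tr sW.
split.
  have sA := sp_algebraB sW sWT.
  rewrite /sp_algebra/= /flow_velocity sympl_invM (sympl_invM _ W) sW.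
  by rewrite !sympl_inv_expmx ?opprK ?mulNmx ?mulmxN ?mulmxA//;
    exact: sp_algebraN.
apply/offdiag_trmx; rewrite rho_flow flow_velocity_trE /offdiag.
move/offdiag_trmx: oW; rewrite /offdiag.
have := flowVK W t; move: (flow W t) (flow_inv W t) (rho U) => E E' P e oW.
rewrite -[in RHS]oW mulmxDr mulmxDl !mulmxA.
by rewrite -(mulmxA _ E' E) e mulmx1 -(mulmxA _ E' E) e mulmx1.
Qed.

(** The velocity of the flow solves the Euler-Poincare equation because its
    skew part is the constant [W - W^T]. *)
Lemma lifted_flow : lifted_SpGr_geodesic U Delta (fun t : R => flow W t *m U).
Proof.
set c := fun t : R => flow W t *m U.
have WU : W *m U = Delta by exact: Omega_bar_mulmx.
have dc (t : R) : is_derive t 1 c (flow_velocity W t *m c t).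
  by rewrite /c mulmxA; exact: is_derive_mulmxr (is_derive_flow W t).
have sc : smooth_curve_in SpSt c.
  split; last exact: SpSt_flow.
  have sF : smooth_curve (flow W) by exact: smooth_flow.
  have sU : smooth_curve (fun=> U) by exact: smooth_cst.
  exact: (smooth_mulmx sF sU).
have hc (t : R) : horizontal_space (c t) (c^`()%classic t).
  rewrite (derive1_val (dc t)).
  by have [] := grass_horizontal_lift (SpSt_flow t) (flow_velocity_horizontal t).
have c0 : c 0 = U by rewrite /c flow0 mul1mx.
have dc0 : c^`()%classic 0 = Delta.
  by rewrite (derive1_val (dc 0)) c0 flow_velocity0.
have srho : smooth_curve_in (SpGr R n k) (rho \o c).
  split; first exact: smooth_rho sc.1.
  by move=> t; apply: rho_SpGr; exact: SpSt_flow.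
have drc (t : R) : (rho \o c)^`()%classic t = drho (c t) (c^`()%classic t).
  exact: derive1_val (is_derive_rho_curve (smooth_is_derive t sc.1)).
have drc0 : (rho \o c)^`()%classic 0 = drho U Delta by rewrite drc c0 dc0.
suff geo : geodesic (SpGr R n k) (gSpGr k) (rho \o c).
  have rc0 : (rho \o c) 0 = rho U by rewrite /comp c0.
  by split; [exact: sc | exact: hc | split; [exact: c0 | exact: dc0] |
    exact: geo | split; [exact: rc0 | exact: drc0]].
apply/(geodesic_lift_eq srho) => t.
have liftE (s : R) : hlift ((rho \o c) s) ((rho \o c)^`()%classic s) =
    flow_velocity W s.
  have [sp oc] := flow_velocity_horizontal s.
  have vE : (rho \o c)^`()%classic s = lie (flow_velocity W s) (rho (c s)).
    by apply: etrans (drc s) _; rewrite (derive1_val (dc s)) drho_mulmx.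
  rewrite vE; exact: hlift_unique (rho_idem (SpSt_flow s)) oc.
rewrite (_ : (fun s => _) = flow_velocity W); last exact/funext.
rewrite liftE -lie_skew_part flow_velocity_skew.
exact: is_derive_flow_velocity.
Qed.

(** The lift of the velocity is that of the flow, and the linear equation
    [c' = flow_velocity c] determines [c]. *)
Lemma lifted_flow_unique c : lifted_SpGr_geodesic U Delta c ->
  forall t : R, c t = flow W t *m U.
Proof.
move=> [sc hc [c0 dc0] geo _] t.
pose w (s : R) := hlift ((rho \o c) s) ((rho \o c)^`()%classic s).
have drc (s : R) : (rho \o c)^`()%classic s = drho (c s) (c^`()%classic s).
  exact: derive1_val (is_derive_rho_curve (smooth_is_derive s sc.1)).
have wE (s : R) : w s = Omega_bar (c s) (c^`()%classic s).
  by rewrite /w drc; exact: horizontal_hlift (sc.2 s) (hc s).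
have srho : smooth_curve_in (SpGr R n k) (rho \o c) by case: geo.
have dw := (geodesic_lift_eq srho).1 geo.
have w0 : w 0 = W by rewrite wE c0 dc0.
have wflow := euler_poincare_unique dw w0.
have dc (s : R) : is_derive s 1 c (flow_velocity W s *m c s).
  rewrite -wflow -/(w s) wE (Omega_bar_mulmx (sc.2 s)).
  exact: smooth_is_derive sc.1.
have dv (s : R) : is_derive s 1 (fun s => flow_inv W s *m c s) 0.
  have := is_derive_mulmx (is_derive_flow_inv W s) (dc s).
  by rewrite mulNmx mulmxA addNr.
have := is_derive_mx0_cst dv t; rewrite flow_inv0 mul1mx c0 => <-.
by rewrite mulmxA flowKV mul1mx.
Qed.

End LiftedGeodesic.

Unset Implicit Arguments.

Theorem proposition4p9 (R : realType) (n k : nat) (k_gt0 : (0 < k)%N)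
    (le_kn : (k <= n)%N) (U Delta : 'M[R]_(n + n, k + k))
    (SpStU : SpSt U) (horDelta : horizontal_space U Delta)
    (c : R -> 'M[R]_(n + n, k + k)) :
  lifted_SpGr_geodesic U Delta c <->
  forall t : R,
    c t = expmx (t *: (Omega_bar U Delta - (Omega_bar U Delta)^T))
          *m expmx (t *: (Omega_bar U Delta)^T) *m U.
Proof.
split=> [|cE]; first exact: lifted_flow_unique.
by rewrite (funext cE); exact: lifted_flow.
Qed.
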